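(* Let $\alpha\in(1/2,2)\setminus\{1\}$ and $p\in(\alpha,2\alpha)\cap[1,2]$. Let $k_0>0$ and let $(\omega_n)_{n\in\mathbb{Z}}$ be a positive weight sequence such that the sequence $(k_n)_{n\in\mathbb{Z}}$ defined by $$k_n:=k_0\mathbf{1}_{\{n\le-1\}}\prod_{l=n+1}^0\frac1{\omega_l}+k_0\mathbf{1}_{\{n\ge0\}}\prod_{l=1}^n\omega_l$$ belongs to $\ell^\alpha(\mathbb{Z})$, and such that there exist $q_-\ge0$, $q_+\ge1$ with $$\eta_-:=\sup_{l\le-q_-}\frac1{\omega_l}<1\quad\text{and}\quad\eta_+:=\sup_{l\ge q_+}\omega_l<1,\qquad \eta_+^{p/2}\ne\eta_-^{\alpha-p/2}.$$ Let $\mu$ be the $\alpha$-stable measure on the complex space $E=\ell^p(\mathbb{Z})$ with characteristic functional $$\int_E e^{i\mathrm{Re}\langle z,x^*\rangle}\mu(dz)=\exp\Big(-\int_E|\mathrm{Re}\langle z,x^*\rangle|^\alpha\,\xi(dz)\Big),\quad x^*\in E^*,\qquad \xi(dz):=\frac12\sum_{n=-\infty}^\infty k_n^\alpha\big(\delta_{e_n}(dz)+\delta_{ie_n}(dz)\big),$$ and let $T$ be the (mixing) weighted forward shift operator on $E$ defined by $Te_n:=\omega_{n+1}e_{n+1}$, $n\in\mathbb{Z}$, assumed to be bounded. Let $(\phi,\psi)$ be a pair of functions in $\{\mathrm{Re}(\cdot),-\mathrm{Re}(\cdot),\mathrm{Im}(\cdot),-\mathrm{Im}(\cdot)\}^2$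 with $\phi\ne\psi$, and let $(a_j)_{j\in\mathbb{N}}$ and $(b_l)_{l\in\mathbb{N}}$ be complex $\ell^1(\mathbb{N})$ sequences such that $$\sum_{j=0}^\infty|a_j|\,\|T\|^{jp/2}<\infty\quad\text{and}\quad\sum_{l=0}^\infty|b_l|\,\|T\|^{lp/2}<\infty.$$ Then, for any $x^*,y^*\in E^*$, the functions $$f(z):=\sum_{j=0}^\infty a_je^{i\phi(\langle z,T^{*j}x^*\rangle)}\quad\text{and}\quad g(z):=\sum_{l=0}^\infty b_le^{i\psi(\langle z,T^{*l}y^*\rangle)}$$ are well-defined in $L^2(E,\mu)$, and $$|I_n(f,g)|=O_{f,g,\mu,T}\Big(\max\big(\eta_-^{2\alpha/p-1},\eta_+\big)^{\alpha n/2}\Big),\qquad n\ge0.$$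
   Context: $(e_n)_{n\in\mathbb{Z}}$ is the canonical basis of $\ell^p(\mathbb{Z})$, $\delta_x$ the Dirac measure at $x$, $\langle\cdot,\cdot\rangle:E\times E^*\to\mathbb{C}$ the duality with the continuous dual $E^*$, $T^*$ the adjoint, $\langle z,T^*x^*\rangle=\langle Tz,x^*\rangle$, and $\|T\|$ the operator norm. $$I_n(f,g):=\int_E f(z)g(T^nz)\,\mu(dz)-\int_E f(z)\,\mu(dz)\int_E g(z)\,\mu(dz),\quad n\ge0.$$ $u(n)=O_{f,g,\mu,T}(v(n))$, $n\ge0$, means $|u(n)|\le C|v(n)|$ for all $n\ge0$ with a constant $C>0$ that may depend on $f,g,\mu,T$ but not on $n$. *)

(* Defs.v *)
From HB Require Import structures.
From mathcomp Require Import all_boot all_order all_algebra.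
From mathcomp Require Import ring lra complex.
From mathcomp Require Import all_classical all_reals all_analysis.

Set Implicit Arguments.
Unset Strict Implicit.
Unset Printing Implicit Defensive.

Import Order.TTheory GRing.Theory Num.Theory numFieldNormedType.Exports.
Import ComplexField ComplexField.Normc.

Local Open Scope classical_set_scope.
Local Open Scope complex_scope.
Local Open Scope ring_scope.

(* lsum q u is the sum of |u n|^q over n in Z; it is finite iff u belongs to
   l^q(Z), for every q > 0. *)
Definition lsum (R : realType) (q : R) (u : int -> R) : \bar R :=
  (\esum_(n in [set: int]) (`|u n| `^ q)%:E)%E.

Section lsum_theory.
Variables (R : realType) (p : R).
Implicit Types (u v w : int -> R) (c s t x : R).

Lemma powRV x : 0 <= x -> x^-1 `^ p = (x `^ p)^-1.
Proof.
by move=> x0; rewrite -powR_inv1// -powRrM mulrC powRrM powR_inv1// powR_ge0.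
Qed.

Lemma lsum_ge0 u : (0 <= lsum p u)%E.
Proof. by apply: esum_ge0 => n _; rewrite lee_fin powR_ge0. Qed.

Lemma le_lsumZ c u : 0 <= c ->
  (\esum_(n in [set: int]) (c * `|u n| `^ p)%:E <= c%:E * lsum p u)%E.
Proof.
move=> c0; apply: ge_ereal_sup => _ [F [Ffin FT] <-].
under eq_fsbigr do rewrite EFinM.
rewrite fsbig_finite//= -ge0_sume_distrr; last first.
  by move=> i _; rewrite lee_fin powR_ge0.
apply: lee_wpmul2l; first by rewrite lee_fin.
rewrite -[X in (X <= _)%E](@fsbig_finite _ _ _ _ F)//=.
by apply: esum_ge; exists F.
Qed.

Lemma lsum_minkowski u v w s t : 1 <= p -> 0 < s -> 0 < t ->
  (forall n, `|w n| <= `|u n| + `|v n|) ->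
  (lsum p u <= (s `^ p)%:E)%E -> (lsum p v <= (t `^ p)%:E)%E ->
  (lsum p w <= ((s + t) `^ p)%:E)%E.
Proof.
move=> p1 s0 t0 wuv us vt.
have st0 : 0 < s + t by rewrite addr_gt0.
have p0 : 0 <= p by rewrite (le_trans _ p1).
pose a : R := (s + t) `^ p * (s / (s + t)) / s `^ p.
pose b : R := (s + t) `^ p * (t / (s + t)) / t `^ p.
have a0 : 0 <= a by rewrite /a !mulr_ge0 ?invr_ge0 ?powR_ge0// ltW.
have b0 : 0 <= b by rewrite /b !mulr_ge0 ?invr_ge0 ?powR_ge0// ltW.
have cvx n : `|w n| `^ p <= a * `|u n| `^ p + b * `|v n| `^ p.
  have l01 : 0 <= s / (s + t) <= 1.
    apply/andP; split; first by apply: divr_ge0; exact: ltW.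
    by rewrite ler_pdivrMr// mul1r lerDl ltW.
  have := @convex_powR R p p1 (Itv01 (proj1 (andP l01)) (proj2 (andP l01)))
    (`|u n| / s) (`|v n| / t).
  rewrite !inE/= !in_itv/= !andbT.
  move=> /(_ (divr_ge0 (normr_ge0 _) (ltW s0))
             (divr_ge0 (normr_ge0 _) (ltW t0))).
  rewrite !convRE/= /unstable.onem => H.
  apply: (@le_trans _ _ ((`|u n| + `|v n|) `^ p)).
    by apply: ge0_ler_powR; rewrite ?nnegrE ?addr_ge0 ?normr_ge0.
  have -> : `|u n| + `|v n| = (s + t) *
     (s / (s + t) * (`|u n| / s) + (1 - s / (s + t)) * (`|v n| / t)).
    by field; rewrite !gt_eqF.
  have s0' := ltW s0; have t0' := ltW t0; have st0' := ltW st0.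
  have cmb0 : 0 <= s / (s + t) * (`|u n| / s) + (1 - s / (s + t)) * (`|v n| / t).
    have [l0 l1] := andP l01.
    by apply: addr_ge0; apply: mulr_ge0; rewrite ?subr_ge0 ?divr_ge0.
  rewrite (powRM _ st0' cmb0).
  apply: (le_trans (ler_wpM2l (powR_ge0 _ _) H)).
  have -> : 1 - s / (s + t) = t / (s + t) by field; rewrite gt_eqF.
  rewrite !(powRM _ (normr_ge0 _)) ?invr_ge0// !powRV// /a /b.
  by rewrite le_eqVlt; apply/orP; left; apply/eqP; ring.
apply: (@le_trans _ _ (a%:E * lsum p u + b%:E * lsum p v)%E).
  apply: (@le_trans _ _ (\esum_(n in [set: int])
     ((a * `|u n| `^ p)%:E + (b * `|v n| `^ p)%:E))%E).
    by apply: le_esum => n _; rewrite -EFinD lee_fin.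
  rewrite esumD; last 2 first.
  - by move=> n _; rewrite lee_fin mulr_ge0 ?powR_ge0.
  - by move=> n _; rewrite lee_fin mulr_ge0 ?powR_ge0.
  by apply: leeD; exact: le_lsumZ.
apply: (@le_trans _ _ (a%:E * (s `^ p)%:E + b%:E * (t `^ p)%:E)%E).
  by apply: leeD; apply: lee_wpmul2l; rewrite ?lee_fin.
rewrite -!EFinM -EFinD lee_fin /a /b le_eqVlt; apply/orP; left; apply/eqP.
rewrite !divfK ?gt_eqF ?powR_gt0// -mulrDr -mulrDl divff ?mulr1//.
by rewrite gt_eqF.
Qed.

Lemma le_lsumM c u : 1 <= p ->
  (lsum p (fun n => (c * u n)%R) <= (`|c| `^ p)%:E * lsum p u)%E.
Proof.
move=> p1; rewrite /lsum; under eq_esum => n _ do rewrite normrM powRM//.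
by apply: le_lsumZ; rewrite powR_ge0.
Qed.

Lemma lsumM c u : 1 <= p ->
  lsum p (fun n => (c * u n)%R) = ((`|c| `^ p)%:E * lsum p u)%E.
Proof.
move=> p1; have p0 : p != 0 by rewrite gt_eqF// (lt_le_trans _ p1).
apply/eqP; rewrite eq_le le_lsumM//=.
have [->|c0] := eqVneq c 0.
  by rewrite normr0 powR0// mul0e lsum_ge0.
rewrite (_ : u = fun n => c^-1 * (c * u n)); last first.
  by apply/funext => n; rewrite mulKf.
set v := (fun n : int => c * u n).
apply: (@le_trans _ _ ((`|c| `^ p)%:E * ((`|c^-1| `^ p)%:E * lsum p v))%E).
  by apply: lee_wpmul2l; rewrite ?lee_fin ?powR_ge0// le_lsumM.
rewrite muleA -EFinM -powRM// -normrM divff// normr1 powR1 mul1e.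
by apply: le_esum => n _; rewrite /v mulKf.
Qed.

Lemma lsum_eq0 u : lsum p u = 0%E -> forall n, u n = 0.
Proof.
move=> u0 n; apply/eqP; rewrite -normr_eq0; apply/eqP/(@powR_eq0_eq0 _ _ p).
have un0 : ((`|u n| `^ p)%:E <= 0 :> \bar R)%E.
  rewrite -u0; apply: esum_ge; exists [set n]; last by rewrite fsbig_set1.
  by split => //; exact: finite_set1.
by apply: le_anti; rewrite powR_ge0 andbT -lee_fin.
Qed.

End lsum_theory.

Section ellp.
Variables (R : realType) (p : R) (p1 : 1 <= p).

Definition ellp_pred : {pred (int -> R[i])} :=
  fun x => (lsum p (fun n => normc (x n)) < +oo)%E.

(* l^p(Z; C). The proof of 1 <= p is a parameter of the type because the
   norm of ellp h, declared below, is a norm only in that range. *)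
Record ellp (h : 1 <= p) : Type := Ellp {
  ellp_val :> int -> R[i];
  _ : ellp_val \in ellp_pred
}.

HB.instance Definition _ := [isSub of ellp p1 for @ellp_val p1].
HB.instance Definition _ := [Choice of ellp p1 by <:].

Lemma normc_ge0 (w : R[i]) : 0 <= normc w.
Proof. by case: w => a b; rewrite /= sqrtr_ge0. Qed.

Lemma lsum_fin (u : int -> R) : (lsum p u < +oo)%E ->
  exists2 s, 0 < s & (lsum p u <= (s `^ p)%:E)%E.
Proof.
move=> uoo; have p0 : 0 < p by rewrite (lt_le_trans _ p1).
have ufin : lsum p u \is a fin_num by rewrite ge0_fin_numE// lsum_ge0.
have f0 : 0 <= fine (lsum p u) by rewrite fine_ge0// lsum_ge0.
exists ((fine (lsum p u) + 1) `^ p^-1); first by rewrite powR_gt0// ltr_wpDl.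
rewrite -powRrM mulVf ?gt_eqF// powRr1 ?addr_ge0//.
by rewrite -[X in (X <= _)%E](fineK ufin) lee_fin lerDl.
Qed.

Lemma ellp_submod : submod_closed ellp_pred.
Proof.
split=> [|c x y xp yp].
  rewrite unfold_in /lsum esum1 ?ltry// => n _.
  rewrite normc0 normr0 powR0// gt_eqF//.
  by rewrite (lt_le_trans _ p1).
rewrite unfold_in.
have cxp : (lsum p (fun n => normc (c * x n)%R) < +oo)%E.
  rewrite (_ : (fun n => _) = (fun n => normc c * normc (x n))); last first.
    by apply/funext => n; rewrite normcM.
  apply: (le_lt_trans (le_lsumM _ _ p1)).
  by rewrite lte_mul_pinfty// ?lee_fin ?powR_ge0.
have [s s0 us] := lsum_fin cxp; have [t t0 vt] := lsum_fin yp.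
apply: (@le_lt_trans _ _ ((s + t) `^ p)%:E); last by rewrite ltry.
apply: (lsum_minkowski p1 s0 t0 _ us vt) => n.
by rewrite !ger0_norm ?normc_ge0//; exact: le_normcD.
Qed.

HB.instance Definition _ :=
  GRing.isSubmodClosed.Build R[i] (int -> R[i]) ellp_pred ellp_submod.
HB.instance Definition _ := [SubChoice_isSubLmodule of ellp p1 by <:].

Definition ellp_norm (x : ellp p1) : R :=
  fine (lsum p (fun n => normc (x n))) `^ p^-1.

Let p0 : 0 < p := lt_le_trans ltr01 p1.

Lemma ellp_lsumE (x : ellp p1) :
  lsum p (fun n => normc (x n)) = ((ellp_norm x) `^ p)%:E.
Proof.
have xoo : (lsum p (fun n => normc (x n)) < +oo)%E by case: x.
rewrite /ellp_norm -powRrM mulVf ?gt_eqF// powRr1 ?fine_ge0 ?lsum_ge0//.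
by rewrite fineK// ge0_fin_numE// lsum_ge0.
Qed.

Lemma ellp_norm_ge0 (x : ellp p1) : 0 <= ellp_norm x.
Proof. exact: powR_ge0. Qed.

Lemma le_ellp_norm (x : ellp p1) (s : R) : 0 <= s ->
  (lsum p (fun n => normc (x n)) <= (s `^ p)%:E)%E -> ellp_norm x <= s.
Proof.
move=> s0; rewrite ellp_lsumE lee_fin => xs; rewrite leNgt; apply/negP => sx.
by move: xs; rewrite leNgt gt0_ltr_powR// nnegrE ellp_norm_ge0.
Qed.

Let lsum_le (x : ellp p1) (e : R) : 0 < e ->
  (lsum p (fun n => normc (x n)) <= ((ellp_norm x + e) `^ p)%:E)%E.
Proof.
move=> e0; rewrite ellp_lsumE lee_fin; apply: ge0_ler_powR.
- exact: ltW.
- by rewrite nnegrE ellp_norm_ge0.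
- by rewrite nnegrE; apply: ltW; apply: ltr_wpDl => //; exact: ellp_norm_ge0.
- by rewrite lerDl; exact: ltW.
Qed.

Lemma ellp_normD (x y : ellp p1) :
  ellp_norm (x + y) <= ellp_norm x + ellp_norm y.
Proof.
have H (e : R) : 0 < e ->
    ellp_norm (x + y) <= (ellp_norm x + e) + (ellp_norm y + e).
  move=> e0; have xe := ltr_wpDl (ellp_norm_ge0 x) e0.
  have ye := ltr_wpDl (ellp_norm_ge0 y) e0.
  apply: (le_ellp_norm (addr_ge0 (ltW xe) (ltW ye))).
  apply: (lsum_minkowski p1 xe ye _ (lsum_le x e0) (lsum_le y e0)) => n.
  rewrite !ger0_norm; [exact: le_normcD|exact: normc_ge0..].
apply/ler_addgt0Pr => e e0.
have /H : 0 < e / 2 by rewrite divr_gt0.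
by rewrite addrACA -splitr.
Qed.

Lemma ellp_normZ (c : R[i]) (x : ellp p1) :
  ellp_norm (c *: x) = normc c * ellp_norm x.
Proof.
rewrite /ellp_norm (_ : (fun n => _) = (fun n => normc c * normc (x n))).
  rewrite lsumM// fineM//; last by rewrite ellp_lsumE.
  rewrite powRM ?powR_ge0 ?fine_ge0 ?lsum_ge0//= -powRrM divff ?gt_eqF//.
  by rewrite powRr1 ?normr_ge0// ger0_norm ?normc_ge0.
by apply/funext => n; rewrite -normcM.
Qed.

Lemma ellp_norm_eq0 (x : ellp p1) : ellp_norm x = 0 -> x = 0.
Proof.
move=> x0; apply/val_inj/funext => n /=; apply: eq0_normc.
apply: (lsum_eq0 (p := p) (u := fun n => normc (x n))).
by rewrite ellp_lsumE x0 powR0// gt_eqF.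
Qed.

Let normC (x : ellp p1) : R[i] := (ellp_norm x)%:C.

Let normCD x y : normC (x + y) <= normC x + normC y.
Proof. by rewrite -rmorphD lecR ellp_normD. Qed.

Let normCZ (c : R[i]) x : normC (c *: x) = `|c| * normC x.
Proof. by rewrite /normC ellp_normZ rmorphM. Qed.

Let normC_eq0 x : normC x = 0 -> x = 0.
Proof. by move=> [] /ellp_norm_eq0. Qed.

HB.instance Definition _ :=
  Lmodule_isNormed.Build R[i] (ellp p1) normCD normCZ normC_eq0.

Lemma ellp_normE (x : ellp p1) : `|x| = (ellp_norm x)%:C.
Proof. by []. Qed.

Definition delta_seq (n m : int) : R[i] := (m == n)%:R.

Lemma delta_seq_ellp n : delta_seq n \in ellp_pred.
Proof.
rewrite unfold_in /lsum (esumID [set n]); last first.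
  by move=> m _; rewrite lee_fin powR_ge0.
rewrite setTI esum_set1 ?lee_fin ?powR_ge0// esum1 ?adde0 ?ltry//.
move=> m [_ /= /eqP/negPf mn]; rewrite /delta_seq mn normc0 normr0.
by rewrite powR0// gt_eqF.
Qed.

Definition ebasis (n : int) : ellp p1 := Ellp p1 (delta_seq_ellp n).

End ellp.

Notation borel V := (g_sigma_algebraType (@open V)).

Definition expi (R : realType) (t : R) : R[i] := cos t +i* sin t.

Section complex_integral.
Context d (T : measurableType d) (R : realType).
Variable mu : {measure set T -> \bar R}.

Definition cintegral (f : T -> R[i]) : R[i] :=
  (\int[mu]_z complex.Re (f z)) +i* (\int[mu]_z complex.Im (f z)).

Definition in_L2 (f : T -> R[i]) : Prop :=
  [/\ measurable_fun setT (fun z => complex.Re (f z)),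
      measurable_fun setT (fun z => complex.Im (f z)) &
      (\int[mu]_z ((normc (f z)) ^+ 2)%:E < +oo)%E].

Definition covariance_at (S : T -> T) (n : nat) (f g : T -> R[i]) : R[i] :=
  cintegral (fun z => f z * g (iter n S z)) - cintegral f * cintegral g.

End complex_integral.

(* For n <= -1 the product of 1 / w l over n + 1 <= l <= 0 is indexed by
   j = - l, which ranges over 0 <= j < |n|. *)
Definition kseq (R : realType) (k0 : R) (w : int -> R) (n : int) : R :=
  if (0 <= n)%R then k0 * \prod_(1 <= l < `|n|%N.+1) w l%:Z
  else k0 * \prod_(0 <= j < `|n|%N) (w (- j%:Z))^-1.

Section shift.
Variables (R : realType) (p : R) (p1 : 1 <= p).
Local Notation E := (ellp p1).

Definition atoms (k : int -> R) (alpha : R) (n : int) :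
    {measure set (borel E) -> \bar R} :=
  mscale (NngNum (powR_ge0 (k n) alpha))
    (measure_add (dirac (ebasis p1 n : borel E))
                 (dirac ('i%C *: ebasis p1 n : borel E))).

(* The sum over Z is split into the sums over n = m >= 0 and over
   n = Negz m = - m - 1 < 0. *)
Definition xi (k : int -> R) (alpha : R) :
    {measure set (borel E) -> \bar R} :=
  mscale (2^-1)%:nng
    (measure_add (mseries (fun m : nat => atoms k alpha (Posz m)) 0)
                 (mseries (fun m : nat => atoms k alpha (Negz m)) 0)).

(* The integral over xi is nonnegative, and finite as soon as k is in l^alpha
   (a continuous xs is bounded on the atoms), so that taking its real value
   loses nothing. *)
Definition has_char_functional (mu xi : {measure set (borel E) -> \bar R})
    (alpha : R) : Prop :=
  forall xs : {linear E -> R[i]^o}, continuous xs ->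
  cintegral mu (fun z => expi (complex.Re (xs z))) =
  (expR (- \int[xi]_z (`|complex.Re (xs z : R[i])| `^ alpha)))%:C.

Definition bounded_operator (T : E -> E) : Prop :=
  exists M : R, forall z, ellp_norm (T z) <= M * ellp_norm z.

Definition opnorm (T : E -> E) : R :=
  sup [set ellp_norm (T z) | z in [set z | ellp_norm z <= 1]].

(* A functional xs in E^* acts by <z, xs> = xs z. *)
Definition adjoint (T : E -> E) (xs : E -> R[i]) : E -> R[i] := xs \o T.

Definition exp_terms (a : nat -> R[i]) (phi : R[i] -> R) (T : E -> E)
    (xs : E -> R[i]) (z : E) : (R[i]^o)^nat :=
  fun j => a j * expi (phi (iter j (adjoint T) xs z)).

Definition exp_series (a : nat -> R[i]) (phi : R[i] -> R) (T : E -> E)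
    (xs : E -> R[i]) (z : E) : R[i] :=
  limn (series (exp_terms a phi T xs z)).

(* The series converges at every z and its sum is square-integrable. *)
Definition exp_series_in_L2 (mu : {measure set (borel E) -> \bar R})
    (a : nat -> R[i]) (phi : R[i] -> R) (T : E -> E) (xs : E -> R[i]) : Prop :=
  (forall z, cvgn (series (exp_terms a phi T xs z))) /\
  in_L2 mu (exp_series a phi T xs).

End shift.

Definition phases (R : realType) : set (R[i] -> R) :=
  [set @complex.Re R; (fun w => - complex.Re w);
       @complex.Im R; (fun w => - complex.Im w)].

(* Main.v *)
Require Import Defs.
From HB Require Import structures.
From mathcomp Require Import all_boot all_order all_algebra.
From mathcomp Require Import ring lra complex.
From mathcomp Require Import all_classical all_reals all_analysis.
From mathcomp Require Import measurable_realfun.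

Set Implicit Arguments.
Unset Strict Implicit.
Unset Printing Implicit Defensive.

Import Order.TTheory GRing.Theory Num.Theory numFieldNormedType.Exports.
Import ComplexField ComplexField.Normc.

Local Open Scope classical_set_scope.
Local Open Scope complex_scope.
Local Open Scope ring_scope.

(** Put [k := kseq k0 w] and, for a continuous functional [F],
      [Phi(F) :=
        1/2 * sum_n (k n)^alpha * (|Re F(e_n)|^alpha + |Im F(e_n)|^alpha)],
    called [char_exponent] below. As [xi] is carried by the vectors [e_n] and
    [i e_n], the characteristic functional of [mu] says that the integral of
    [exp (i Re F)] is [exp (- Phi(F))] ([cintegral_expi]).

    Each of the four phases is [w |-> Re (c * w)] with [|c| = 1], so the terms of
    both series are exponentials of real parts of functionals [F = c * xs o T^i] and
    [G = d * ys o T^(j + n)], and so is the product of two of them. The covariance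
    of two terms is therefore [exp (- Phi(F + G)) - exp (- Phi(F) - Phi(G))], which
    is at most [|Phi(F + G) - Phi(F) - Phi(G)|]. For [0 <= alpha <= 2],
      [| |x + y|^alpha - |x|^alpha - |y|^alpha | <= 2 * |x * y|^(alpha / 2)]
    ([powR_normD_le]), so the covariance is bounded by a multiple of
    [sum_m (k m)^alpha * |F(e_m) * G(e_m)|^(alpha / 2)] ([codifference_le]).

    Since [T^i e_m = (k (m + i) / k m) e_(m + i)], this sum is at most a constant
    times [sum_m kap (m + i) * kap (m + j + n)], where [kap := k^(alpha / 2)]. Now
    [kap m] is [O (t^m)] at [+oo] and [O (s^|m|)] at [-oo], with
    [t = etap^(alpha / 2)] and [s = etam^(alpha / 2)]. If [t <= r < 1] and [s < r],
    then [kap m = O (r^m)] on all of Z and [sum_m kap m * r^m] is finite, which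
    together bound the correlation by a constant times [r^(n + j - i)]
    ([weight_correlation_le]). The choice
    [r = max (etam^(2 * alpha / p - 1), etap)^(alpha / 2)] satisfies these
    conditions because [2 * alpha / p - 1] lies in the open interval (0, 1).

    Finally [r^-i] has to be summed against [a_i]. As [p > alpha] and the norm of
    [T] is at least [1 / etam], one has [1 / r <= ||T||^(p / 2)] ([rate_inv_le]), so
    the weighted summability of [a] is exactly what is needed. The passage from
    single terms to the two series is a general statement on bounded bilinear
    forms ([covariance_at_series_le]). *)

(** * Inequalities for real powers *)

(** After division by [(x + y) `^ b] this is [z <= z `^ b] for [z] in [[0, 1]],
    applied to the two fractions [x / (x + y)] and [y / (x + y)]. *)
Lemma powR_subadditive (R : realType) (b x y : R) :
  0 <= b <= 1 -> 0 <= x -> 0 <= y -> (x + y) `^ b <= x `^ b + y `^ b.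
Proof.
move=> /andP[b0 b1]; rewrite le_eqVlt => /predU1P[<- _|xp].
  by rewrite add0r lerDr powR_ge0.
rewrite le_eqVlt => /predU1P[<-|yp]; first by rewrite addr0 lerDl powR_ge0.
have sp : 0 < x + y by rewrite addr_gt0.
have le z : 0 < z <= x + y -> (x + y) `^ b * (z / (x + y)) <= z `^ b.
  move=> /andP[zp zs].
  have -> : z `^ b = (x + y) `^ b * (z / (x + y)) `^ b.
    by rewrite -powRM ?divr_ge0 ?ltW// mulrC divfK// gt_eqF.
  rewrite ler_wpM2l ?powR_ge0// ger1_powR// divr_gt0//=.
  by rewrite ler_pdivrMr// mul1r.
apply: (le_trans _ (lerD (le x _) (le y _))); last 2 first.
- by rewrite xp lerDl ltW.
- by rewrite yp lerDr ltW.
by rewrite -mulrDr -mulrDl divff ?mulr1// gt_eqF.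
Qed.

(** By subadditivity of the power [a / 2], the numbers [`|x| `^ (a / 2)],
    [`|y| `^ (a / 2)] and [`|x + y| `^ (a / 2)] satisfy the three triangle
    inequalities; squaring them gives both bounds, with the same constant 2 on
    the whole range of [a]. *)
Lemma powR_normD_le (R : realType) (a x y : R) : 0 <= a <= 2 ->
  `|x + y| `^ a <=
    `|x| `^ a + `|y| `^ a + 2 * (`|x| `^ (a / 2) * `|y| `^ (a / 2)) /\
  `|x| `^ a + `|y| `^ a <=
    `|x + y| `^ a + 2 * (`|x| `^ (a / 2) * `|y| `^ (a / 2)).
Proof.
move=> /andP[a0 a2].
have b01 : 0 <= a / 2 <= 1 by lra.
have b0 : 0 <= a / 2 by lra.
have sq (z : R) : `|z| `^ a = (`|z| `^ (a / 2)) ^+ 2.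
  by rewrite -powR_mulrn ?powR_ge0// -powRrM divfK.
have tri (u v : R) : `|u + v| `^ (a / 2) <= `|u| `^ (a / 2) + `|v| `^ (a / 2).
  apply: le_trans (powR_subadditive b01 (normr_ge0 _) (normr_ge0 _)).
  by apply: ge0_ler_powR; rewrite ?nnegrE ?addr_ge0 ?ler_normD.
have := tri x y; have := tri (x + y) (- y); have := tri (x + y) (- x).
rewrite addrK [x + y - x]addrC addKr !normrN !sq.
have := powR_ge0 `|x| (a / 2); have := powR_ge0 `|y| (a / 2).
have := powR_ge0 `|x + y| (a / 2).
move: (_ `^ _) (_ `^ _) (_ `^ _) => Z Y X *.
by split; nra.
Qed.

Lemma normr_expRN_sub_le (R : realType) (x y d : R) : 0 <= x -> 0 <= y ->
  x <= y + d -> y <= x + d -> `|expR (- x) - expR (- y)| <= d.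
Proof.
wlog xy : x y / x <= y.
  move=> H x0 y0 xd yd; have [xy|yx] := leP x y; first exact: H.
  by rewrite distrC; apply: H => //; exact: ltW.
move=> x0 y0 _ yd.
rewrite ger0_norm ?subr_ge0 ?ler_expR ?lerN2//.
have -> : expR (- x) - expR (- y) = expR (- x) * (1 - expR (- (y - x))).
  by rewrite mulrBr mulr1 -expRD; congr (_ - expR _); ring.
have e1 : expR (- x) <= 1 by rewrite -expR0 ler_expR oppr_le0.
have e0 := expR_ge0 (- x).
have := expR_ge1Dx (- (y - x)).
have : expR (- (y - x)) <= 1 by rewrite -expR0 ler_expR oppr_le0 subr_ge0.
nra.
Qed.

(** The finitely many indices below [q] only affect the constant; each step of
    the induction on [q] absorbs the first value of the sequence in it. *)
Lemma geometric_bound (R : realType) (c : nat -> R) (t : R) (q : nat) :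
  0 < t -> (forall n, 0 <= c n) ->
  (forall n, (q <= n)%N -> c n.+1 <= t * c n) ->
  exists2 K : R, 0 <= K & forall n, c n <= K * t ^+ n.
Proof.
move=> t0; elim: q c => [|q IH] c c0 ct.
  exists (c 0%N) => //; elim=> [|n IHn]; first by rewrite expr0 mulr1.
  by rewrite (le_trans (ct _ _))// exprS mulrCA ler_pM2l.
have [|n qn|K K0 cK] := IH (fun n => c n.+1); first by [].
  by apply: ct; rewrite ltnS.
exists (Num.max (c 0%N) (K / t)) => [|[|n]].
- by rewrite le_max c0.
- by rewrite expr0 mulr1 le_max lexx.
rewrite (le_trans (cK n))// exprS mulrA ler_wpM2r ?exprn_ge0 ?(ltW t0)//.
by rewrite -ler_pdivrMr// le_max lexx orbT.
Qed.

(** * Dominated series of complex numbers *)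

Section complex_norm.
Variable R : realType.
Implicit Types w : R[i].

Lemma normr_Re_le w : `|complex.Re w| <= normc w.
Proof. by have := normc_ge_Re w; rewrite -lecR. Qed.

Lemma normr_Im_le w : `|complex.Im w| <= normc w.
Proof.
case: w => a b; rewrite /= -sqrtr_sqr ler_sqrt ?addr_ge0 ?sqr_ge0//.
by rewrite lerDr sqr_ge0.
Qed.

Lemma normc_le_ReIm w : normc w <= `|complex.Re w| + `|complex.Im w|.
Proof.
case: w => a b /=.
rewrite -(@ler_pXn2r _ 2)// ?nnegrE ?addr_ge0 ?sqrtr_ge0// sqr_sqrtr.
  rewrite sqrrD !real_normK ?num_real//.
  by have := mulr_ge0 (normr_ge0 a) (normr_ge0 b); lra.
by rewrite addr_ge0 ?sqr_ge0.
Qed.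

Lemma normc_real (x : R) : normc x%:C = `|x|.
Proof. by rewrite /= expr0n/= addr0 sqrtr_sqr. Qed.

Lemma Re_mul (x y : R[i]) : complex.Re (x * y) =
  complex.Re x * complex.Re y - complex.Im x * complex.Im y.
Proof. by case: x y => [? ?] [? ?]. Qed.

Lemma Im_mul (x y : R[i]) : complex.Im (x * y) =
  complex.Re x * complex.Im y + complex.Im x * complex.Re y.
Proof. by case: x y => [? ?] [? ?]. Qed.

Lemma Re_series (c : nat -> R[i]) n :
  complex.Re (\sum_(0 <= j < n) c j) = \sum_(0 <= j < n) complex.Re (c j).
Proof. exact: raddf_sum. Qed.

Lemma Im_series (c : nat -> R[i]) n :
  complex.Im (\sum_(0 <= j < n) c j) = \sum_(0 <= j < n) complex.Im (c j).
Proof. exact: raddf_sum. Qed.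

Lemma series_le_lim (e : nat -> R) (A : R) J : (forall j, 0 <= e j) ->
  series e @ \oo --> A -> \sum_(0 <= j < J) e j <= A.
Proof.
move=> e0 eA; have <- : limn (series e) = A by exact: cvg_lim.
exact: (nondecreasing_cvgn_le
  (nondecreasing_series (fun n _ _ => e0 n)) (cvgP _ eA)).
Qed.

Lemma real_series_dominated (x e : nat -> R) (A : R) :
  (forall j, `|x j| <= e j) -> series e @ \oo --> A ->
  exists2 s : R, series x @ \oo --> s &
    forall J, `|s - series x J| <= A - series e J.
Proof.
move=> xe eA.
have cx : cvgn (series x).
  apply: normed_cvg; apply: (@series_le_cvg _ _ e) => //.
  - by move=> n; exact: normr_ge0.
  - by move=> n; exact: le_trans (normr_ge0 _) (xe n).
  - by apply: cvgP eA.
exists (limn (series x)) => // J.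
have cJ : `|series x n - series x J| @[n --> \oo] -->
    `|limn (series x) - series x J|.
  by apply: cvg_norm; apply: cvgB => //; exact: cvg_cst.
have eJ : series e n - series e J @[n --> \oo] --> A - series e J.
  by apply: cvgB => //; exact: cvg_cst.
apply: (ler_cvg_to cJ eJ).
near=> n.
have Jn : (J <= n)%N by near: n; exact: nbhs_infty_ge.
rewrite !sub_series Jn.
by apply: le_trans (ler_norm_sum _ _ _) _; apply: ler_sum.
Unshelve. all: by end_near. Qed.

(** The convergence of the real and imaginary parts is recorded for the sake of
    measurability. The bound on the remainder depends on the dominating series
    only, so it is uniform when the terms are functions. *)
Lemma complex_series_dominated (c : nat -> R[i]) (e : nat -> R) (A : R) :
  (forall j, normc (c j) <= e j) -> series e @ \oo --> A ->
  exists S : R[i], [/\ series (c : (R[i]^o)^nat) @ \oo --> (S : R[i]^o),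
    complex.Re (series c n) @[n --> \oo] --> complex.Re S,
    complex.Im (series c n) @[n --> \oo] --> complex.Im S &
    forall J, normc (S - series c J) <= 2 * (A - series e J)].
Proof.
move=> ce eA.
have [|s cs sJ] := @real_series_dominated (fun j => complex.Re (c j)) e A _ eA.
  by move=> j; rewrite (le_trans (normr_Re_le _)).
have [|t ct tJ] := @real_series_dominated (fun j => complex.Im (c j)) e A _ eA.
  by move=> j; rewrite (le_trans (normr_Im_le _)).
have SJ J : normc ((s +i* t) - series c J) <= 2 * (A - series e J).
  rewrite (le_trans (normc_le_ReIm _))// mulr_natl mulr2n lerD//.
  - by rewrite raddfB/= [X in _ - X]Re_series; exact: sJ.
  - by rewrite raddfB/= [X in _ - X]Im_series; exact: tJ.
exists (s +i* t); split => //.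
- apply/cvgrPdist_lt => eps; rewrite ltcE => /andP[/eqP eps0 epsR].
  have eJ : 2 * (A - series e n) @[n --> \oo] --> 0.
    rewrite -(mulr0 2) -(subrr A); apply: cvgMr; apply: cvgB => //.
    exact: cvg_cst.
  near=> n.
  have : 2 * (A - series e n) < complex.Re eps.
    by near: n; apply: (cvgr_lt _ eJ).
  move=> /(le_lt_trans (SJ n)) seps.
  by rewrite ltcE eps0 eqxx.
- by under eq_fun do rewrite Re_series.
- by under eq_fun do rewrite Im_series.
Unshelve. all: by end_near. Qed.

End complex_norm.

(** * Bounded measurable complex functions *)

Section bounded_complex_functions.
Context d (T : measurableType d) (R : realType).
Implicit Types (f g : T -> R[i]) (B : R) (c : R[i]).

Definition bmfun B f := [/\ measurable_fun setT (fun z => complex.Re (f z)),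
  measurable_fun setT (fun z => complex.Im (f z)) & forall z, normc (f z) <= B].

Lemma bmfun_cst c : bmfun (normc c) (fun=> c).
Proof. by split => //; exact: measurable_cst. Qed.

Lemma bmfunD B f B' g : bmfun B f -> bmfun B' g ->
  bmfun (B + B') (fun z => f z + g z).
Proof.
move=> [rf jf bf] [rg jg bg]; split.
- under eq_fun do rewrite raddfD; exact: measurable_funD.
- under eq_fun do rewrite raddfD; exact: measurable_funD.
- by move=> z; rewrite (le_trans (le_normcD _ _)) ?lerD.
Qed.

Lemma bmfunM B f B' g : bmfun B f -> bmfun B' g ->
  bmfun (B * B') (fun z => f z * g z).
Proof.
move=> [rf jf bf] [rg jg bg]; split.
- under eq_fun do rewrite Re_mul; apply: measurable_funB; exact: measurable_funM.
- under eq_fun do rewrite Im_mul; apply: measurable_funD; exact: measurable_funM.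
- by move=> z; rewrite normcM ler_pM ?normc_ge0.
Qed.

Lemma bmfunZ B f c : bmfun B f -> bmfun (normc c * B) (fun z => c * f z).
Proof. exact/bmfunM/bmfun_cst. Qed.

Lemma bmfun_sum (a : nat -> R[i]) (u : nat -> T -> R[i]) J :
  (forall j, bmfun 1 (u j)) ->
  bmfun (\sum_(0 <= j < J) normc (a j)) (fun z => \sum_(0 <= j < J) a j * u j z).
Proof.
move=> ub; elim: J => [|J IH].
  rewrite big_geq// -(normc0 R) (_ : (fun _ => _) = fun=> 0).
    exact: bmfun_cst.
  by apply/funext => z; rewrite big_geq.
rewrite big_nat_recr//= -[normc (a J)]mulr1.
rewrite (_ : (fun _ => _) =
  fun z => \sum_(0 <= j < J) a j * u j z + a J * u J z).
  by apply: bmfunD => //; exact: bmfunZ.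
by apply/funext => z; rewrite big_nat_recr.
Qed.

(** The last clause is uniform on the whole space: it is what lets a bounded
    functional pass to the limit of the series. *)
Lemma bmfun_series (a : nat -> R[i]) (u : nat -> T -> R[i]) (A : R) :
  series (fun j => normc (a j)) @ \oo --> A -> (forall j, bmfun 1 (u j)) ->
  exists f, [/\ bmfun (2 * A) f,
    forall z, series ((fun j => a j * u j z) : (R[i]^o)^nat) @ \oo -->
      (f z : R[i]^o) &
    forall J, bmfun (2 * (A - series (fun j => normc (a j)) J))
      (fun z => f z - \sum_(0 <= j < J) a j * u j z)].
Proof.
move=> aA ub.
have aub z j : normc (a j * u j z) <= normc (a j).
  by rewrite normcM ler_piMr ?normc_ge0//; have [_ _] := ub j; exact.
have /choice[f fP] z :=
  @complex_series_dominated _ (fun j => a j * u j z) _ A (aub z) aA.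
have mRe : measurable_fun setT (fun z => complex.Re (f z)).
  apply: (@measurable_fun_cvg _ _ _ _
    (fun n z => complex.Re (series (fun j => a j * u j z) n))) => [n|z _].
    by have [] := bmfun_sum a n ub.
  by have [] := fP z.
have mIm : measurable_fun setT (fun z => complex.Im (f z)).
  apply: (@measurable_fun_cvg _ _ _ _
    (fun n z => complex.Im (series (fun j => a j * u j z) n))) => [n|z _].
    by have [] := bmfun_sum a n ub.
  by have [] := fP z.
exists f; split => [|z|J].
- split => // z; have [_ _ _ /(_ 0%N)] := fP z.
  by rewrite /series/= !big_geq// !subr0.
- by have [] := fP z.
- have [mR mI _] := bmfun_sum a J ub.
  split => [||z]; last by have [_ _ _ /(_ J)] := fP z.
  + by under eq_fun do rewrite raddfB; exact: measurable_funB.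
  + by under eq_fun do rewrite raddfB; exact: measurable_funB.
Qed.

End bounded_complex_functions.

(** * Integrals of bounded complex functions *)

Section cintegral_bmfun.
Context d (T : measurableType d) (R : realType) (mu : probability T R).
Implicit Types (f g : T -> R[i]) (B : R) (c : R[i]).

Lemma bmfun_integrable B f : bmfun B f ->
  mu.-integrable setT (EFin \o (fun z => complex.Re (f z))) /\
  mu.-integrable setT (EFin \o (fun z => complex.Im (f z))).
Proof.
move=> [mR mI fB].
have mT : (mu setT < +oo)%E by rewrite probability_setT ltry.
split; apply: measurable_bounded_integrable => //; exists B;
  split; rewrite ?num_real// => M BM z _.
- exact: le_trans (le_trans (normr_Re_le _) (fB z)) (ltW BM).
- exact: le_trans (le_trans (normr_Im_le _) (fB z)) (ltW BM).
Qed.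

Lemma cintegralD B f B' g : bmfun B f -> bmfun B' g ->
  cintegral mu (fun z => f z + g z) = cintegral mu f + cintegral mu g.
Proof.
move=> /bmfun_integrable[fR fI] /bmfun_integrable[gR gI].
rewrite /cintegral; under eq_Rintegral do rewrite raddfD.
rewrite RintegralD//.
by under [in X in _ +i* X]eq_Rintegral do rewrite raddfD; rewrite RintegralD.
Qed.

Lemma cintegralZ B f c : bmfun B f ->
  cintegral mu (fun z => c * f z) = c * cintegral mu f.
Proof.
move=> /bmfun_integrable[fR fI].
have iZ (r : R) (h : T -> R) : mu.-integrable setT (EFin \o h) ->
    mu.-integrable setT (EFin \o (fun z => r * h z)).
  exact: integrableZl.
rewrite /cintegral; under eq_Rintegral do rewrite Re_mul.
rewrite RintegralB ?RintegralZl//; [|exact: iZ..].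
under [in X in _ +i* X]eq_Rintegral do rewrite Im_mul.
rewrite RintegralD ?RintegralZl//; [|exact: iZ..].
by case: c.
Qed.

(** The factor 2 comes from bounding the two parts of the integral separately.
    It is harmless, because this bound only enters estimates of remainders that
    tend to 0. *)
Lemma normc_cintegral_le B f : bmfun B f -> normc (cintegral mu f) <= 2 * B.
Proof.
move=> bf; have [fR fI] := bmfun_integrable bf; have [mR mI fB] := bf.
have bnd (h : T -> R) : mu.-integrable setT (EFin \o h) ->
    (forall z, `|h z| <= B) -> `|\int[mu]_z h z| <= B.
  move=> ih hB; apply: le_trans (le_normr_Rintegral _ ih) _ => //.
  have -> : B = \int[mu]_(_ in setT) B.
    by rewrite Rintegral_cst//= probability_setT mulr1.
  apply: le_Rintegral => //.
  - exact: integrable_norm.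
  - exact: finite_measure_integrable_cst.
rewrite (le_trans (normc_le_ReIm _))// mulr_natl mulr2n lerD//=.
- by apply: bnd => // z; rewrite (le_trans (normr_Re_le _)).
- by apply: bnd => // z; rewrite (le_trans (normr_Im_le _)).
Qed.

Lemma bmfun_in_L2 B f : bmfun B f -> in_L2 mu f.
Proof.
move=> [mR mI fB]; split => //.
have nE z : normc (f z) ^+ 2 = complex.Re (f z) ^+ 2 + complex.Im (f z) ^+ 2.
  by case: (f z) => a b /=; rewrite sqr_sqrtr// addr_ge0 ?sqr_ge0.
have mN : measurable_fun setT (fun z => (normc (f z) ^+ 2)%:E).
  apply/measurable_EFinP; under eq_fun do rewrite nE.
  by apply: measurable_funD; exact: measurable_funX.
have : (\int[mu]_z (normc (f z) ^+ 2)%:E <= \int[mu]_(z in setT) (B ^+ 2)%:E)%E.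
  apply: ge0_le_integral => //.
  - by move=> z _; rewrite lee_fin sqr_ge0.
  - move=> z _; rewrite lee_fin lerXn2r ?nnegrE ?normc_ge0//.
    by rewrite (le_trans _ (fB z))// normc_ge0.
move=> /le_lt_trans; apply.
by rewrite integral_cst//= probability_setT mule1 ltry.
Qed.

End cintegral_bmfun.

(** * Bounded functionals and covariances of series *)

Section functional_on_series.
Context d (T : measurableType d) (R : realType).
Variables (L : (T -> R[i]) -> R[i]) (M : R).
Hypothesis LD : forall B f B' g, bmfun B f -> bmfun B' g ->
  L (fun z => f z + g z) = L f + L g.
Hypothesis LZ : forall B f c, bmfun B f -> L (fun z => c * f z) = c * L f.
Hypothesis LB : forall B f, bmfun B f -> normc (L f) <= M * B.

Lemma functional_sum_le (a : nat -> R[i]) (u : nat -> T -> R[i])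
    (D : nat -> R) J :
  (forall j, bmfun 1 (u j)) -> (forall j, normc (L (u j)) <= D j) ->
  normc (L (fun z => \sum_(0 <= j < J) a j * u j z)) <=
  \sum_(0 <= j < J) normc (a j) * D j.
Proof.
move=> ub LuD; elim: J => [|J IH].
  rewrite big_geq// (_ : (fun _ => _) = fun _ => 0 * 0).
    by rewrite (LZ 0 (bmfun_cst T 0)) mul0r normc0.
  by apply/funext => z; rewrite big_geq// mul0r.
rewrite (_ : (fun _ => _) =
  fun z => \sum_(0 <= j < J) a j * u j z + a J * u J z).
  rewrite (LD (bmfun_sum a J ub) (bmfunZ (a J) (ub J))) (LZ _ (ub J)).
  rewrite (le_trans (le_normcD _ _))// big_nat_recr//= lerD//.
  by rewrite normcM ler_wpM2l ?normc_ge0.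
by apply/funext => z; rewrite big_nat_recr.
Qed.

(** Subtracting a partial sum from [f] leaves a function that is uniformly small,
    hence on which [L] is small; on the partial sum the bound is the triangle
    inequality. *)
Lemma functional_series_le (a : nat -> R[i]) (u : nat -> T -> R[i]) (A C : R)
    (D : nat -> R) (f : T -> R[i]) :
  series (fun j => normc (a j)) @ \oo --> A ->
  (forall j, bmfun 1 (u j)) -> (forall j, normc (L (u j)) <= D j) ->
  (forall J, \sum_(0 <= j < J) normc (a j) * D j <= C) ->
  (forall z, series ((fun j => a j * u j z) : (R[i]^o)^nat) @ \oo -->
     (f z : R[i]^o)) ->
  normc (L f) <= C.
Proof.
move=> aA ub LuD DC fz.
have [g [bg gz gJ]] := bmfun_series aA ub.
have -> : f = g.
  apply/funext => z; apply: (cvg_unique _ (fz z) (gz z)).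
  exact: norm_hausdorff.
have H J : normc (L g) <= M * (2 * (A - series (fun j => normc (a j)) J)) + C.
  rewrite (_ : g = fun z => (g z - \sum_(0 <= j < J) a j * u j z) +
      \sum_(0 <= j < J) a j * u j z); last by apply/funext => z; rewrite subrK.
  rewrite (LD (gJ J) (bmfun_sum a J ub)) (le_trans (le_normcD _ _))// lerD//.
    exact: LB.
  by rewrite (le_trans (functional_sum_le _ _ ub LuD)).
have lim : M * (2 * (A - series (fun j => normc (a j)) J)) + C @[J --> \oo] --> C.
  rewrite -[X in _ --> X]add0r; apply: cvgD; last exact: cvg_cst.
  rewrite -(mulr0 M); apply: cvgMr; rewrite -(mulr0 2); apply: cvgMr.
  by rewrite -(subrr A); apply: cvgB => //; exact: cvg_cst.
apply: (ler_cvg_to (cvg_cst _) lim).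
exact: nearW.
Qed.

End functional_on_series.

Section covariance.
Context d (T : measurableType d) (R : realType) (mu : probability T R).
Variables (S : T -> T) (n : nat).
Hypothesis mS : measurable_fun setT (iter n S).
Implicit Types (f g : T -> R[i]) (B : R) (c : R[i]).

Lemma bmfun_iter B f : bmfun B f -> bmfun B (fun z => f (iter n S z)).
Proof.
move=> [mR mI fB]; split => //.
- exact: (measurableT_comp (f := fun z => complex.Re (f z))).
- exact: (measurableT_comp (f := fun z => complex.Im (f z))).
Qed.

Let bmfun_prod B f B' g : bmfun B f -> bmfun B' g ->
  bmfun (B * B') (fun z => f z * g (iter n S z)).
Proof. by move=> bf bg; apply: bmfunM => //; exact: bmfun_iter. Qed.

Lemma covariance_atDl B f B' f' B'' g : bmfun B f -> bmfun B' f' -> bmfun B'' g ->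
  covariance_at mu S n (fun z => f z + f' z) g =
  covariance_at mu S n f g + covariance_at mu S n f' g.
Proof.
move=> bf bf' bg; rewrite /covariance_at (cintegralD mu bf bf').
rewrite (_ : (fun z => (f z + f' z) * g (iter n S z)) =
  fun z => f z * g (iter n S z) + f' z * g (iter n S z)); last first.
  by apply/funext => z; rewrite mulrDl.
by rewrite (cintegralD mu (bmfun_prod bf bg) (bmfun_prod bf' bg)); ring.
Qed.

Lemma covariance_atDr B f B' g B'' g' : bmfun B f -> bmfun B' g -> bmfun B'' g' ->
  covariance_at mu S n f (fun z => g z + g' z) =
  covariance_at mu S n f g + covariance_at mu S n f g'.
Proof.
move=> bf bg bg'; rewrite /covariance_at (cintegralD mu bg bg').
rewrite (_ : (fun z => f z * (g (iter n S z) + g' (iter n S z))) =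
  fun z => f z * g (iter n S z) + f z * g' (iter n S z)); last first.
  by apply/funext => z; rewrite mulrDr.
by rewrite (cintegralD mu (bmfun_prod bf bg) (bmfun_prod bf bg')); ring.
Qed.

Lemma covariance_atZl B f B' g c : bmfun B f -> bmfun B' g ->
  covariance_at mu S n (fun z => c * f z) g = c * covariance_at mu S n f g.
Proof.
move=> bf bg; rewrite /covariance_at (cintegralZ mu c bf).
rewrite (_ : (fun z => c * f z * g (iter n S z)) =
  fun z => c * (f z * g (iter n S z))); last first.
  by apply/funext => z; rewrite mulrA.
by rewrite (cintegralZ mu c (bmfun_prod bf bg)); ring.
Qed.

Lemma covariance_atZr B f B' g c : bmfun B f -> bmfun B' g ->
  covariance_at mu S n f (fun z => c * g z) = c * covariance_at mu S n f g.
Proof.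
move=> bf bg; rewrite /covariance_at (cintegralZ mu c bg).
rewrite (_ : (fun z => f z * (c * g (iter n S z))) =
  fun z => c * (f z * g (iter n S z))); last first.
  by apply/funext => z; rewrite mulrCA.
by rewrite (cintegralZ mu c (bmfun_prod bf bg)); ring.
Qed.

Lemma normc_covariance_at_le B f B' g : bmfun B f -> bmfun B' g ->
  normc (covariance_at mu S n f g) <= 6 * (B * B').
Proof.
move=> bf bg; rewrite /covariance_at.
have h0 := normc_cintegral_le mu (bmfun_prod bf bg).
have h1 := normc_cintegral_le mu bf; have h2 := normc_cintegral_le mu bg.
rewrite (le_trans (le_normcD _ _))// normcN normcM.
have := ler_pM (normc_ge0 _) (normc_ge0 _) h1 h2.
by move: h0; move: (normc _) (normc _ * normc _) => ? ? ? ?; lra.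
Qed.

(** The covariance is a bounded linear functional of each argument, so the bound
    for a single pair of terms is summed over [j] and then over [i]. *)
Lemma covariance_at_series_le (a b : nat -> R[i]) (u v : nat -> T -> R[i])
    (A B Bg Q K : R) (q : nat -> R) f g :
  series (fun i => normc (a i)) @ \oo --> A ->
  series (fun j => normc (b j)) @ \oo --> B ->
  (forall i, bmfun 1 (u i)) -> (forall j, bmfun 1 (v j)) -> bmfun Bg g ->
  (forall z, series ((fun i => a i * u i z) : (R[i]^o)^nat) @ \oo -->
     (f z : R[i]^o)) ->
  (forall z, series ((fun j => b j * v j z) : (R[i]^o)^nat) @ \oo -->
     (g z : R[i]^o)) ->
  0 <= K -> (forall i, 0 <= q i) ->
  (forall i j, normc (covariance_at mu S n (u i) (v j)) <= K * q i) ->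
  (forall J, \sum_(0 <= i < J) normc (a i) * q i <= Q) ->
  normc (covariance_at mu S n f g) <= K * B * Q.
Proof.
move=> aA bB ub vb gb fz gz K0 q0 cov leQ.
have leB J := series_le_lim J (fun j => normc_ge0 (b j)) bB.
have B0 : 0 <= B by have := leB 0%N; rewrite big_geq.
have inner i : normc (covariance_at mu S n (u i) g) <= K * B * q i.
  apply: (functional_series_le (L := covariance_at mu S n (u i)) (M := 6)
    (D := fun=> K * q i) _ _ _ bB vb (cov i) _ gz).
  - by move=> B1 h1 B2 h2 b1 b2; exact: covariance_atDr (ub i) b1 b2.
  - by move=> B1 h1 c b1; exact: covariance_atZr c (ub i) b1.
  - by move=> B1 h1 b1; have := normc_covariance_at_le (ub i) b1; rewrite mul1r.
  - move=> J; rewrite -mulr_suml mulrC mulrAC ler_wpM2r//.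
    by rewrite ler_wpM2l.
apply: (functional_series_le (L := fun h => covariance_at mu S n h g)
  (M := 6 * Bg) _ _ _ aA ub inner _ fz).
- by move=> B1 h1 B2 h2 b1 b2; exact: covariance_atDl b1 b2 gb.
- by move=> B1 h1 c b1; exact: covariance_atZl c b1 gb.
- move=> B1 h1 b1; rewrite (le_trans (normc_covariance_at_le b1 gb))//.
  by rewrite -mulrA [B1 * _]mulrC.
- move=> J; have KB0 : 0 <= K * B by exact: mulr_ge0.
  apply: (le_trans _ (ler_wpM2l KB0 (leQ J))); rewrite mulr_sumr.
  by apply: ler_sum => i _; rewrite mulrCA.
Qed.

End covariance.

(** * Sums over the integers *)

Section sums_over_int.
Variable R : realType.
Implicit Types (a : int -> R) (f : int -> \bar R).

Lemma esum_scale_le a (c : R) : 0 <= c -> (forall n, 0 <= a n) ->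
  (\esum_(n in [set: int]) (c * a n)%:E <=
   c%:E * \esum_(n in [set: int]) (a n)%:E)%E.
Proof.
move=> c0 a0; have := @le_lsumZ R 1 c a c0.
have E n : `|a n| `^ 1 = a n by rewrite powRr1 ?ger0_norm.
rewrite /lsum; under eq_esum do rewrite E.
by under [X in (_ <= _ * X)%E -> _]eq_esum do rewrite E.
Qed.

Lemma esum_shift f (j : int) :
  (\esum_(n in [set: int]) f n = \esum_(n in [set: int]) f (n + j)%R)%E.
Proof.
apply: (@reindex_esum _ _ _ _ _ (fun n => n + j)); split => //.
- by move=> x y _ _ /addIr.
- by move=> x _; exists (x - j) => //; rewrite subrK.
Qed.

Lemma esum_int f : (forall n, (0 <= f n)%E) ->
  (\esum_(n in [set: int]) f n =
   \sum_(0 <= m <oo) f (Posz m) + \sum_(0 <= m <oo) f (Negz m))%E.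
Proof.
move=> f0; rewrite (esumID [set n | 0 <= n])// setTI; congr (_ + _)%E.
- rewrite nneseries_esumT//; apply: reindex_esum; split.
  + by move=> m _ /=.
  + by move=> x y _ _ [].
  + by move=> [m|m] //= _; exists m.
- rewrite nneseries_esumT// setTI; apply: reindex_esum; split.
  + by move=> m _ /=.
  + by move=> x y _ _ [].
  + by move=> [m|m] //= H; exists m.
Qed.

Lemma nneseries_le_lim (e : nat -> R) (A : R) : (forall j, 0 <= e j) ->
  series e @ \oo --> A -> (\sum_(0 <= j <oo) (e j)%:E <= A%:E)%E.
Proof.
move=> e0 eA; apply: lime_le.
  by apply: is_cvg_nneseries => j _ _; rewrite lee_fin.
by apply: nearW => n; rewrite sumEFin lee_fin; exact: series_le_lim.
Qed.

Lemma nneseries_geometric_lty (c : nat -> R) (K x : R) :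
  0 <= x < 1 -> (forall n, 0 <= c n <= K * x ^+ n) ->
  (\sum_(0 <= n <oo) (c n)%:E < +oo)%E.
Proof.
move=> /andP[x0 x1] cK.
have H : series (geometric K x) @ \oo --> K * (1 - x)^-1.
  by apply: cvg_geometric_series; rewrite ger0_norm.
apply: le_lt_trans (ltry (K * (1 - x)^-1)).
apply: le_trans (nneseries_le_lim _ H).
  apply: lee_nneseries => n _; first by rewrite lee_fin; case/andP: (cK n).
  by rewrite lee_fin; case/andP: (cK n).
by move=> n; apply: le_trans (proj2 (andP (cK n))); case/andP: (cK n).
Qed.

End sums_over_int.

(** * Decay and correlations of the weights *)

Section weights.
Variables (R : realType) (k0 : R) (w : int -> R).
Hypotheses (k0_gt0 : 0 < k0) (w_gt0 : forall n, 0 < w n).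
Local Notation k := (kseq k0 w).

Lemma kseq_gt0 n : 0 < k n.
Proof.
rewrite /kseq; case: ifP => _; rewrite mulr_gt0// prodr_gt0// => i _.
by rewrite invr_gt0.
Qed.

(** By this recursion on all of Z the shift sends [k n *: e_n] to
    [k (n + 1) *: e_(n + 1)], hence translates the atoms of the spectral measure. *)
Lemma kseqS n : k (n + 1) = w (n + 1) * k n.
Proof.
case: n => n.
  by rewrite /kseq/= addn1 big_nat_recr//= mulrA mulrC -PoszD addn1.
rewrite /kseq; case: n => [|n].
  by rewrite /= big_geq// big_nat1 mulr1 oppr0 mulrCA divff ?mulr1// gt_eqF.
have -> : Negz n.+1 + 1 = Negz n by rewrite !NegzE -addn1 PoszD opprD addrNK.
rewrite /= [in RHS]big_nat_recr//= -NegzE mulrCA [w _ * _]mulrC.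
by rewrite mulfVK// gt_eqF.
Qed.

Variables (alpha s t r : R) (qm qp : nat).
Local Notation kap n := (k n `^ (alpha / 2)).
Hypotheses (s0 : 0 < s) (t0 : 0 < t) (sr : s < r) (tr : t <= r) (r1 : r < 1).
Hypothesis kapP : forall n : nat, (qp <= n)%N -> kap (n.+1)%:Z <= t * kap n%:Z.
Hypothesis kapN : forall n : nat, (qm <= n)%N ->
  kap (- n.+1%:Z) <= s * kap (- n%:Z).

Let r0 : 0 < r := lt_trans s0 sr.

Lemma weight_decay : exists2 K : R, 0 <= K &
  (forall n : nat, kap n%:Z <= K * t ^+ n) /\
  (forall n : nat, kap (- n%:Z) <= K * s ^+ n).
Proof.
have [K K0 HK] :=
  geometric_bound t0 (fun n => powR_ge0 (k n%:Z) (alpha / 2)) kapP.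
have [K' K'0 HK'] :=
  geometric_bound s0 (fun n => powR_ge0 (k (- n%:Z)) (alpha / 2)) kapN.
exists (Num.max K K'); first by rewrite le_max K0.
split => n.
- by rewrite (le_trans (HK n))// ler_wpM2r ?exprn_ge0 ?(ltW t0)// le_max lexx.
- rewrite (le_trans (HK' n))// ler_wpM2r ?exprn_ge0 ?(ltW s0)//.
  by rewrite le_max lexx orbT.
Qed.

(** For negative [n] the right-hand side is at least [K], as [r < 1]. *)
Lemma weight_le_exprz :
  exists2 K : R, 0 <= K & forall n : int, kap n <= K * r ^ n.
Proof.
have [K K0 [Kt Ks]] := weight_decay.
exists K => // -[n|n].
  rewrite (le_trans (Kt n))// ler_wpM2l//.
  by apply: lerXn2r; rewrite ?nnegrE// ltW.
rewrite NegzE (le_trans (Ks _))// ler_wpM2l// -exprnN.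
apply: (@le_trans _ _ 1); first by rewrite exprn_ile1// ?ltW// (lt_trans sr).
by rewrite invf_ge1 ?exprn_gt0// exprn_ile1// ltW.
Qed.

(** At [+oo] the terms decay like [(t * r) ^+ n], at [-oo] like [(s / r) ^+ n]:
    this is where the strict inequality [s < r] matters. *)
Lemma weight_exprz_summable :
  (\esum_(n in [set: int]) (kap n * r ^ n)%:E < +oo)%E.
Proof.
have [K K0 [Kt Ks]] := weight_decay.
have ge0 n : 0 <= kap n * r ^ n by rewrite mulr_ge0 ?powR_ge0// exprz_ge0// ltW.
rewrite esum_int; last by move=> n; rewrite lee_fin.
apply: lte_add_pinfty.
- apply: (@nneseries_geometric_lty _ _ K (t * r)).
    rewrite mulr_ge0 ?(ltW t0) ?(ltW r0)//=.
    by rewrite mulr_ilt1 ?(ltW t0) ?(ltW r0)// (le_lt_trans tr).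
  by move=> n; rewrite ge0/= exprMn mulrA ler_wpM2r// exprn_ge0// ltW.
- apply: (@nneseries_geometric_lty _ _ (K * (s / r)) (s / r)).
    by rewrite divr_ge0 ?(ltW s0) ?(ltW r0)//= ltr_pdivrMr// mul1r.
  move=> n; rewrite ge0/= NegzE -exprnN -mulrA -exprS expr_div_n mulrA.
  by rewrite ler_wpM2r// invr_ge0 exprn_ge0// ltW.
Qed.

(** Only the factor shifted by [j] is replaced by its bound [K * r ^ (m + j)],
    which is [r ^ (m + i)] times [r ^ (j - i)]; after the change of index
    [m + i] the remaining sum does not depend on [i] and [j]. As the bound holds
    on all of Z, both signs of [j - i] are covered at once. *)
Lemma weight_correlation_le : exists2 S : R, 0 <= S & forall i j : nat,
  (\esum_(m in [set: int]) (kap (m + i%:Z) * kap (m + j%:Z))%:E <=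
   (S * r ^+ j / r ^+ i)%:E)%E.
Proof.
have [K K0 HK] := weight_le_exprz; have Sfin := weight_exprz_summable.
set S := (\esum_(n in [set: int]) (kap n * r ^ n)%:E)%E in Sfin.
have rge0 (n : int) : 0 <= r ^ n by rewrite exprz_ge0// ltW.
have S0 : (0 <= S)%E.
  by apply: esum_ge0 => n _; rewrite lee_fin mulr_ge0 ?powR_ge0.
have SE : S = (fine S)%:E by rewrite fineK// ge0_fin_numE.
exists (K * fine S) => [|i j]; first by rewrite mulr_ge0// fine_ge0.
apply: (@le_trans _ _ (\esum_(m in [set: int])
    (K * r ^+ j / r ^+ i * (kap (m + i%:Z) * r ^ (m + i%:Z)))%:E)%E).
  apply: le_esum => m _; rewrite lee_fin mulrCA ler_wpM2l ?powR_ge0//.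
  rewrite (le_trans (HK _))// !expfzDr ?gt_eqF//= -!exprnP.
  rewrite le_eqVlt; apply/orP; left; apply/eqP; field.
  by rewrite expf_neq0// gt_eqF.
have c0 : 0 <= K * r ^+ j / r ^+ i by rewrite divr_ge0 ?mulr_ge0 ?exprn_ge0// ltW.
apply: (le_trans (esum_scale_le c0 _)).
  by move=> n; rewrite mulr_ge0 ?powR_ge0.
rewrite -(esum_shift (fun n => (kap n * r ^ n)%:E) i%:Z) -/S SE -EFinM lee_fin.
by rewrite le_eqVlt; apply/orP; left; apply/eqP; ring.
Qed.

End weights.

(** * Borel measurability of continuous functions *)

Section borel_measurability.
Context (V : ptopologicalType) (R : realType).

Lemma continuous_borel_measurable (f : V -> R) :
  continuous f -> measurable_fun setT (f : borel V -> R).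
Proof.
move=> /continuousP cf; apply: (measurability _ (RGenOpens.measurableE R)).
move=> _ [_ [a [b ->] <-]]; rewrite setTI; apply: sub_sigma_algebra.
exact/cf/interval_open.
Qed.

Lemma continuous_borel_measurable_self (S : V -> V) :
  continuous S -> measurable_fun setT (S : borel V -> borel V).
Proof.
move=> /continuousP cS.
apply: (@measurability _ _ (borel V) (borel V) setT S (@open V) erefl).
move=> _ [A oA <-]; rewrite setTI; apply: sub_sigma_algebra; exact: cS.
Qed.

Lemma continuous_Re (f : V -> R[i]^o) :
  continuous f -> continuous (fun z => complex.Re (f z) : R).
Proof.
move=> cf z; apply/cvgrPdist_lt => e e0.
have e0C : 0 < (e%:C : R[i]) by rewrite ltcR.
have /cvgrPdist_lt/(_ _ e0C) := cf z.
apply: filterS => t; rewrite ltcE => /andP[_]; apply: le_lt_trans.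
by rewrite -raddfB; exact: normr_Re_le.
Qed.

Lemma normc_expi (t : R) : normc (expi t) = 1.
Proof. by rewrite /= cos2Dsin2 sqrtr1. Qed.

Lemma expiD (s t : R) : expi (s + t) = expi s * expi t.
Proof. by rewrite /expi cosD sinD [X in _ +i* X]addrC. Qed.

Lemma bmfun_expi (f : V -> R[i]^o) : continuous f ->
  bmfun 1 (fun z : borel V => expi (complex.Re (f z))).
Proof.
move=> /continuous_Re/continuous_borel_measurable mf; split.
- apply: (measurableT_comp (f := cos)) => //.
  by apply: continuous_measurable_fun; exact: continuous_cos.
- apply: (measurableT_comp (f := sin)) => //.
  by apply: continuous_measurable_fun; exact: continuous_sin.
- by move=> z; rewrite normc_expi.
Qed.

End borel_measurability.

(** * The characteristic functional and the codifference *)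

(** [scaled_sum_le] and [scaled_sum_ge] put the estimates for the real parts ([x])
    and for the imaginary parts ([y]) under their common weight [K]. *)
Lemma scaled_sum_le (R : realFieldType) (K x y x1 x2 y1 y2 u1 u2 v : R) :
  0 <= K -> x <= x1 + x2 + u1 -> y <= y1 + y2 + u2 -> u1 <= 2 * v -> u2 <= 2 * v ->
  K * (x + y) <= K * (x1 + y1) + K * (x2 + y2) + 4 * (K * v).
Proof.
move=> K0 hx hy h1 h2; rewrite mulrCA -!mulrDr ler_wpM2l//; lra.
Qed.

Lemma scaled_sum_ge (R : realFieldType) (K x y x1 x2 y1 y2 u1 u2 v : R) :
  0 <= K -> x1 + x2 <= x + u1 -> y1 + y2 <= y + u2 -> u1 <= 2 * v -> u2 <= 2 * v ->
  K * (x1 + y1) + K * (x2 + y2) <= K * (x + y) + 4 * (K * v).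
Proof.
move=> K0 hx hy h1 h2; rewrite mulrCA -!mulrDr ler_wpM2l//; lra.
Qed.

Section characteristic_functional.
Variables (R : realType) (p : R) (p1 : 1 <= p).
Local Notation E := (ellp p1).
Variables (k : int -> R) (alpha : R).
Hypotheses (k0 : forall n, 0 <= k n) (alpha0 : 0 < alpha).
Hypothesis ksum : (lsum alpha k < +oo)%E.

Definition char_term (h : E -> R[i]) (n : int) : R :=
  k n `^ alpha * (`|complex.Re (h (ebasis p1 n))| `^ alpha +
                  `|complex.Im (h (ebasis p1 n))| `^ alpha).

Definition char_exponent (h : E -> R[i]) : R :=
  2^-1 * fine (\esum_(n in [set: int]) (char_term h n)%:E)%E.

Lemma char_term_ge0 h n : 0 <= char_term h n.
Proof. by rewrite mulr_ge0 ?addr_ge0 ?powR_ge0. Qed.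

Lemma char_exponent_ge0 h : 0 <= char_exponent h.
Proof.
by rewrite mulr_ge0// fine_ge0// esum_ge0// => n _; rewrite lee_fin char_term_ge0.
Qed.

(** The atoms at the [n]-th basis vector and at ['i] times it contribute the real
    and the imaginary part of the value of [h] there. *)
Lemma integral_xi (h : {linear E -> R[i]^o}) : continuous h ->
  (\int[xi p1 k alpha]_z (`|complex.Re (h z : R[i])| `^ alpha)%:E =
   2^-1%:E * \esum_(n in [set: int]) (char_term h n)%:E)%E.
Proof.
move=> ch; set H := fun z : borel E => (`|complex.Re (h z : R[i])| `^ alpha)%:E.
have H0 z : [set: borel E] z -> (0 <= H z)%E.
  by move=> _; rewrite lee_fin powR_ge0.
have mH : measurable_fun [set: borel E] H.
  apply/measurable_EFinP.
  apply: (@measurableT_comp _ _ _ _ _ _ (fun x : R => x `^ alpha)).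
    exact: measurable_powR.
  apply: measurableT_comp => //; apply: continuous_borel_measurable.
  exact: continuous_Re.
have atomsE n : (\int[atoms p1 k alpha n]_z H z = (char_term h n)%:E)%E.
  rewrite ge0_integral_mscale// ge0_integral_measure_add//.
  rewrite !integral_dirac// !diracE !mem_set// !mul1e /H -EFinD -EFinM/=.
  congr (_ * (_ + _))%:E; congr (_ `^ _).
  have -> : h ('i%C *: ebasis p1 n) = 'i%C * h (ebasis p1 n).
    exact: linearZ.
  by case: (h _) => a b /=; rewrite mul0r mul1r sub0r normrN.
rewrite ge0_integral_mscale// ge0_integral_measure_add//; congr (_ * _)%E.
rewrite !ge0_integral_measure_series// esum_int.
  by congr (_ + _)%E; apply: eq_eseriesr => m _; rewrite atomsE.
by move=> n; rewrite lee_fin char_term_ge0.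
Qed.

Lemma char_term_summable (h : E -> R[i]) (B : R) :
  (forall n, normc (h (ebasis p1 n)) <= B) ->
  (\esum_(n in [set: int]) (char_term h n)%:E < +oo)%E.
Proof.
move=> hB.
have pw (x : R) : `|x| <= B -> `|x| `^ alpha <= B `^ alpha.
  move=> xB; apply: ge0_ler_powR; rewrite ?nnegrE ?(ltW alpha0)//.
  exact: le_trans xB.
have B2 : 0 <= B `^ alpha + B `^ alpha by rewrite addr_ge0 ?powR_ge0.
apply: (@le_lt_trans _ _ ((B `^ alpha + B `^ alpha)%:E * lsum alpha k)%E).
  apply: le_trans (le_lsumZ _ _ B2); apply: le_esum => n _.
  rewrite lee_fin /char_term mulrC (ger0_norm (k0 n)) ler_wpM2r ?powR_ge0//.
  apply: lerD; apply: pw.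
    by rewrite (le_trans (normr_Re_le _)).
  by rewrite (le_trans (normr_Im_le _)).
by rewrite lte_mul_pinfty ?lee_fin.
Qed.

Lemma cintegral_expi (mu : {measure set (borel E) -> \bar R})
    (h : {linear E -> R[i]^o}) :
  has_char_functional mu (xi p1 k alpha) alpha -> continuous h ->
  (\esum_(n in [set: int]) (char_term h n)%:E < +oo)%E ->
  cintegral mu (fun z => expi (complex.Re (h z))) = (expR (- char_exponent h))%:C.
Proof.
move=> hmu ch hfin; rewrite hmu//; congr ((expR (- _))%:C).
rewrite /Rintegral integral_xi// fineM// ge0_fin_numE// esum_ge0// => n _.
by rewrite lee_fin char_term_ge0.
Qed.

(** The codifference of two stable variables: since [expR (- _)] is 1-Lipschitz
    on nonnegative numbers, it is enough to compare the exponents, which is done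
    term by term with [powR_normD_le] for the real and the imaginary parts. *)
Lemma codifference_le (f g h : E -> R[i]) (D : R) : alpha <= 2 ->
  (forall n, h (ebasis p1 n) = f (ebasis p1 n) + g (ebasis p1 n)) ->
  (\esum_(n in [set: int]) (char_term f n)%:E < +oo)%E ->
  (\esum_(n in [set: int]) (char_term g n)%:E < +oo)%E ->
  (\esum_(n in [set: int]) (char_term h n)%:E < +oo)%E ->
  (\esum_(n in [set: int]) (k n `^ alpha *
     (normc (f (ebasis p1 n)) * normc (g (ebasis p1 n))) `^ (alpha / 2))%:E <=
   D%:E)%E ->
  `|expR (- char_exponent h) -
    expR (- char_exponent f) * expR (- char_exponent g)| <= 2 * D.
Proof.
move=> alpha2 hfg ffin gfin hfin DD.
set dl := fun n => k n `^ alpha *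
  (normc (f (ebasis p1 n)) * normc (g (ebasis p1 n))) `^ (alpha / 2).
have dl0 n : 0 <= dl n by rewrite mulr_ge0 ?powR_ge0.
have a02 : 0 <= alpha <= 2 by rewrite (ltW alpha0).
have cross (x y X Y : R) : `|x| <= X -> `|y| <= Y ->
    2 * (`|x| `^ (alpha / 2) * `|y| `^ (alpha / 2)) <= 2 * (X * Y) `^ (alpha / 2).
  move=> xX yY; rewrite ler_pM2l// -powRM//.
  have X0 : 0 <= X by exact: le_trans xX.
  have Y0 : 0 <= Y by exact: le_trans yY.
  apply: ge0_ler_powR; rewrite ?nnegrE ?mulr_ge0// ?ler_pM//.
  exact: ltW.
have term n : char_term h n <= char_term f n + char_term g n + 4 * dl n /\
    char_term f n + char_term g n <= char_term h n + 4 * dl n.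
  rewrite /char_term hfg !raddfD /dl/=.
  have [A1 A2] := powR_normD_le (complex.Re (f (ebasis p1 n)))
    (complex.Re (g (ebasis p1 n))) a02.
  have [B1 B2] := powR_normD_le (complex.Im (f (ebasis p1 n)))
    (complex.Im (g (ebasis p1 n))) a02.
  have C1 := cross _ _ _ _ (normr_Re_le (f (ebasis p1 n)))
    (normr_Re_le (g (ebasis p1 n))).
  have C2 := cross _ _ _ _ (normr_Im_le (f (ebasis p1 n)))
    (normr_Im_le (g (ebasis p1 n))).
  have K0 := powR_ge0 (k n) alpha.
  by split; [exact: scaled_sum_le A1 B1 C1 C2|
    exact: scaled_sum_ge A2 B2 C1 C2].
have tE (u : E -> R[i]) : (\esum_(n in [set: int]) (char_term u n)%:E < +oo)%E ->
    (\esum_(n in [set: int]) (char_term u n)%:E)%E = (2 * char_exponent u)%:E.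
  move=> ufin; rewrite /char_exponent mulrA divff// mul1r fineK//.
  by rewrite ge0_fin_numE// esum_ge0// => n _; rewrite lee_fin char_term_ge0.
have t0 u n : (0 <= (char_term u n)%:E)%E by rewrite lee_fin char_term_ge0.
have dE : (\esum_(n in [set: int]) (4 * dl n)%:E <= (4 * D)%:E)%E.
  by rewrite (le_trans (esum_scale_le _ dl0))// EFinM lee_pmul2l.
have d0 n : (0 <= (4 * dl n)%:E)%E by rewrite lee_fin mulr_ge0.
rewrite -expRD -opprD; apply: normr_expRN_sub_le.
- exact: char_exponent_ge0.
- by rewrite addr_ge0 ?char_exponent_ge0.
- have : (\esum_(n in [set: int]) (char_term h n)%:E <=
    \esum_(n in [set: int])
      ((char_term f n)%:E + (char_term g n)%:E + (4 * dl n)%:E))%E.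
    by apply: le_esum => n _; rewrite -!EFinD lee_fin; have [] := term n.
  rewrite esumD//; last by move=> n _; rewrite adde_ge0.
  rewrite esumD// (tE h)// (tE f)// (tE g)// => H.
  have := le_trans H (leeD2l _ dE).
  rewrite -!EFinD lee_fin.
  by move: (char_exponent _) (char_exponent _) (char_exponent _) => ? ? ? ?; lra.
- have : (\esum_(n in [set: int]) ((char_term f n)%:E + (char_term g n)%:E) <=
    \esum_(n in [set: int]) ((char_term h n)%:E + (4 * dl n)%:E))%E.
    by apply: le_esum => n _; rewrite -!EFinD lee_fin; have [] := term n.
  rewrite !esumD// (tE h)// (tE f)// (tE g)// => H.
  have := le_trans H (leeD2l _ dE).
  rewrite -!EFinD lee_fin.
  by move: (char_exponent _) (char_exponent _) (char_exponent _) => ? ? ? ?; lra.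
Qed.

End characteristic_functional.

(** * Operators and functionals on the sequence space *)

Section ellp_operators.
Variables (R : realType) (p : R) (p1 : 1 <= p).
Local Notation E := (ellp p1).

Lemma ellp_norm_ebasis n : ellp_norm (ebasis p1 n) = 1.
Proof.
rewrite /ellp_norm (_ : lsum _ _ = 1%E) /= ?powR1//.
rewrite /lsum (esumID [set n]); last by move=> m _; rewrite lee_fin powR_ge0.
rewrite setTI esum_set1 ?lee_fin ?powR_ge0// esum1 ?adde0.
  by rewrite /delta_seq eqxx normc1 normr1 powR1.
move=> m [_ /= /eqP/negPf mn]; rewrite /delta_seq mn normc0 normr0.
by rewrite powR0// gt_eqF// (lt_le_trans _ p1).
Qed.

Lemma functional_bounded (F : {linear E -> R[i]^o}) : continuous F ->
  exists2 B : R, 0 <= B & forall n, normc (F (ebasis p1 n)) <= B.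
Proof.
move=> /linear_bounded_continuous/linear_boundedP/pinfty_ex_gt0[r r0 rF].
have rE : r = (complex.Re r)%:C by rewrite RRe_real// gtr0_real.
exists (complex.Re r); first by move: r0; rewrite rE ltcR => /ltW.
move=> n; have := rF (ebasis p1 n); rewrite ellp_normE ellp_norm_ebasis mulr1.
by rewrite [in X in _ <= X -> _]rE -lecR.
Qed.

Lemma bounded_operator_continuous (T : {linear E -> E}) :
  bounded_operator T -> continuous T.
Proof.
move=> [M TM]; apply/linear_bounded_continuous/bounded_funP => r.
exists (`|M|%:C * r) => x xr; rewrite ellp_normE.
apply: (@le_trans _ _ (`|M| * ellp_norm x)%:C).
  by rewrite lecR (le_trans (TM x))// ler_wpM2r ?ellp_norm_ge0// ler_norm.
by rewrite rmorphM ler_wpM2l// lecR.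
Qed.

Lemma le_opnorm (T : E -> E) z : bounded_operator T -> ellp_norm z <= 1 ->
  ellp_norm (T z) <= opnorm T.
Proof.
move=> [M TM] z1; apply: ub_le_sup; last by exists z.
exists `|M| => _ [x /= x1 <-]; rewrite (le_trans (TM x))//.
rewrite (le_trans (ler_norm _))// normrM ler_piMr//.
by rewrite ger0_norm// ellp_norm_ge0.
Qed.

Lemma continuous_iter (T : E -> E) n : continuous T -> continuous (iter n T).
Proof.
move=> cT; elim: n => [|n IH] z /=; first exact: cvg_id.
by apply: continuous_comp; [exact: IH|exact: cT].
Qed.

(** The functional [c * <T^j z, xs>]. It is stated for plain functions, so that it
    can be compared with the terms of the exponential series; linearity is a
    lemma, and [to_functional] bundles it. *)
Definition pullback (T : E -> E) (c : R[i]) (xs : E -> R[i]) j : E -> R[i]^o :=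
  fun z => c * xs (iter j T z).

Lemma continuous_pullback (T : E -> E) c (xs : E -> R[i]^o) j :
  continuous T -> continuous xs -> continuous (pullback T c xs j).
Proof.
move=> cT cxs z.
have cz : {for z, continuous (fun z => xs (iter j T z))}.
  by apply: continuous_comp; [exact: continuous_iter|exact: cxs].
exact: (continuous_comp cz (@scaler_continuous _ R[i]^o c _)).
Qed.

Lemma iter_linear (T : {linear E -> E}) j : linear (iter j T).
Proof. by move=> a x y; elim: j => //= j ->; rewrite linearP. Qed.

Lemma pullback_linear (T : {linear E -> E}) c (xs : {linear E -> R[i]^o}) j :
  linear (pullback T c xs j).
Proof.
move=> a x y; rewrite /pullback iter_linear linearP mulrDr; congr (_ + _).
exact: mulrCA.
Qed.

Definition to_functional (F : E -> R[i]^o) (lF : linear F) :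
  {linear E -> R[i]^o} :=
  HB.pack F (GRing.isLinear.Build R[i] E R[i]^o *:%R F lF).

End ellp_operators.

(** * Series of exponentials of a functional *)

(** A phase is the real part of a rotation, which turns every term of the
    exponential series into an instance of the characteristic functional. *)
Lemma phasesP (R : realType) (phi : R[i] -> R) : phases phi ->
  exists2 c : R[i], normc c = 1 & forall w, phi w = complex.Re (c * w).
Proof.
move=> [[[->|->]|->]|->].
- by exists 1; [exact: normc1|move=> w; rewrite mul1r].
- by exists (-1); [rewrite normcN normc1|move=> w; rewrite mulN1r raddfN].
- exists (- 'i%C); last by case=> a b /=; rewrite oppr0 mul0r sub0r mulN1r opprK.
  by rewrite normcN /= expr0n expr1n add0r sqrtr1.
- exists 'i%C; last by case=> a b /=; rewrite mul0r sub0r mul1r.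
  by rewrite /= expr0n expr1n add0r sqrtr1.
Qed.

Section exponential_series.
Variables (R : realType) (p : R) (p1 : 1 <= p).
Local Notation E := (ellp p1).
Variables (mu : probability (borel E) R) (T : {linear E -> E}).
Hypothesis cT : continuous T.
Variables (a : nat -> R[i]) (A : R) (phi : R[i] -> R) (c : R[i]).
Variable xs : {linear E -> R[i]^o}.
Hypotheses (aA : series (fun j => normc (a j)) @ \oo --> A) (cxs : continuous xs).
Hypothesis phiE : forall w, phi w = complex.Re (c * w).

Definition phase_wave (j : nat) (z : borel E) : R[i] :=
  expi (complex.Re (pullback T c xs j z)).

Lemma bmfun_phase_wave j : bmfun 1 (phase_wave j).
Proof. by apply: bmfun_expi; exact: continuous_pullback. Qed.

Lemma exp_termsE z : exp_terms a phi T xs z = fun j => a j * phase_wave j z.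
Proof.
apply/funext => j; rewrite /exp_terms /phase_wave phiE.
congr (_ * expi (complex.Re (_ * _))).
by elim: j z => //= j IH z; rewrite /adjoint/= -/(adjoint T _) IH -iterSr.
Qed.

Lemma exp_series_bmfun :
  [/\ exp_series_in_L2 mu a phi T xs,
      bmfun (2 * A) (exp_series a phi T xs : borel E -> R[i]) &
      forall z : borel E,
        series ((fun j => a j * phase_wave j z) : (R[i]^o)^nat) @ \oo -->
        (exp_series a phi T xs z : R[i]^o)].
Proof.
have [f [bf fz _]] := bmfun_series aA bmfun_phase_wave.
have fE : exp_series a phi T xs = f.
  apply/funext => z; rewrite /exp_series exp_termsE.
  by apply: (cvg_lim _ (fz z)); exact: norm_hausdorff.
rewrite fE; split; [split|exact: bf|exact: fz].
  by move=> z; rewrite exp_termsE; exact: cvgP (fz z).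
by rewrite fE; exact: bmfun_in_L2 bf.
Qed.

End exponential_series.

(** * The weighted shift *)

Section weighted_shift.
Variables (R : realType) (p : R) (p1 : 1 <= p) (k0 : R) (w : int -> R).
Local Notation E := (ellp p1).
Local Notation e := (ebasis p1).
Local Notation k := (kseq k0 w).
Hypotheses (k0_gt0 : 0 < k0) (w_gt0 : forall n, 0 < w n).
Variable T : {linear E -> E}.
Hypothesis Te : forall n : int, T (e n) = (w (n + 1))%:C *: e (n + 1).
Variable alpha : R.
Hypothesis alpha0 : 0 < alpha.

Let k_gt0 n : 0 < k n := kseq_gt0 k0_gt0 w_gt0 n.

Lemma iter_shift_ebasis j n :
  iter j T (e n) = (k (n + j%:Z) / k n)%:C *: e (n + j%:Z).
Proof.
elim: j => [|j IH]; first by rewrite addr0 divff ?gt_eqF// scale1r.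
rewrite iterS IH linearZ_LR Te scalerA -rmorphM -[j.+1]addn1 PoszD addrA kseqS//.
by congr (_%:C *: _); rewrite mulrC mulrA.
Qed.

Lemma pullback_ebasis c (xs : {linear E -> R[i]^o}) j n :
  pullback T c xs j (e n) = (k (n + j%:Z) / k n)%:C * (c * xs (e (n + j%:Z))).
Proof.
rewrite /pullback iter_shift_ebasis.
have -> : xs ((k (n + j%:Z) / k n)%:C *: e (n + j%:Z)) =
  (k (n + j%:Z) / k n)%:C * xs (e (n + j%:Z)) by exact: linearZ.
exact: mulrCA.
Qed.

Lemma char_term_pullback c (xs : {linear E -> R[i]^o}) j n :
  char_term k alpha (pullback T c xs j) n =
  char_term k alpha (pullback T c xs 0) (n + j%:Z).
Proof.
rewrite /char_term (pullback_ebasis c xs j n) (pullback_ebasis c xs 0) addr0.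
rewrite (divff (lt0r_neq0 (k_gt0 (n + j%:Z)))) mul1r.
set q := k _ / k n; move: (c * _) => v.
have q0 : 0 <= q by rewrite divr_ge0// ltW.
have kq : k n * q = k (n + j%:Z) by rewrite mulrC divfK// lt0r_neq0.
clearbody q.
have -> : complex.Re (q%:C * v) = q * complex.Re v.
  by rewrite Re_mul/= mul0r subr0.
have -> : complex.Im (q%:C * v) = q * complex.Im v.
  by rewrite Im_mul/= mul0r addr0.
rewrite !(normrM q) (ger0_norm q0) !powRM// -mulrDr mulrA -powRM// ?kq//.
exact: ltW.
Qed.

(** The invariance of the measure under the shift, at the level of characteristic
    exponents: [T^j] translates the index [n] by [j], and so does the sum over Z. *)
Lemma char_exponent_pullback c (xs : {linear E -> R[i]^o}) j :
  char_exponent k alpha (pullback T c xs j) =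
  char_exponent k alpha (pullback T c xs 0).
Proof.
rewrite /char_exponent; congr (_ * fine _).
rewrite [RHS](esum_shift _ j%:Z); apply: eq_esum => n _.
by rewrite char_term_pullback.
Qed.

(** The factor [k n `^ alpha] cancels the two denominators [k n] exactly. *)
Lemma cross_term_pullback_le c d (xs ys : {linear E -> R[i]^o}) Bx By i j n :
  normc c = 1 -> normc d = 1 -> 0 <= Bx -> 0 <= By ->
  (forall m, normc (xs (e m)) <= Bx) -> (forall m, normc (ys (e m)) <= By) ->
  k n `^ alpha * (normc (pullback T c xs i (e n)) *
                  normc (pullback T d ys j (e n))) `^ (alpha / 2) <=
  (Bx * By) `^ (alpha / 2) *
    (k (n + i%:Z) `^ (alpha / 2) * k (n + j%:Z) `^ (alpha / 2)).
Proof.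
move=> c1 d1 Bx0 By0 xB yB.
have kge0 m : 0 <= k m by rewrite ltW.
have q0 m : 0 <= k m / k n by rewrite divr_ge0.
have -> : k n `^ alpha = (k n * k n) `^ (alpha / 2).
  by rewrite powRM// -powRD -?splitr// ?gt_eqF ?implybT.
rewrite -!powRM ?mulr_ge0 ?normc_ge0//.
apply: ge0_ler_powR; rewrite ?nnegrE ?mulr_ge0 ?normc_ge0//.
  exact: ltW.
rewrite !pullback_ebasis !normcM c1 d1 !mul1r !normc_real !(ger0_norm (q0 _)).
have -> : k n * k n * (k (n + i%:Z) / k n * normc (xs (e (n + i%:Z))) *
   (k (n + j%:Z) / k n * normc (ys (e (n + j%:Z))))) =
   normc (xs (e (n + i%:Z))) * normc (ys (e (n + j%:Z))) *
   (k (n + i%:Z) * k (n + j%:Z)).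
  by field; rewrite gt_eqF.
by rewrite ler_wpM2r ?mulr_ge0// ler_pM ?normc_ge0.
Qed.

Lemma pullback_bounded c (xs : {linear E -> R[i]^o}) j :
  continuous T -> continuous xs ->
  exists B, forall n, normc (pullback T c xs j (e n)) <= B.
Proof.
move=> cT cxs.
have [B _ HB] := functional_bounded
  (F := to_functional (pullback_linear T c xs j)) (continuous_pullback cT cxs).
by exists B.
Qed.

Hypotheses (alpha2 : alpha <= 2) (ksum : (lsum alpha k < +oo)%E).
Hypothesis cT : continuous T.
Variable mu : probability (borel E) R.
Hypothesis hmu : has_char_functional mu (xi p1 k alpha) alpha.

Lemma cintegral_phase_wave c (xs : {linear E -> R[i]^o}) j : continuous xs ->
  cintegral mu (phase_wave T c xs j) =
  (expR (- char_exponent k alpha (pullback T c xs 0)))%:C.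
Proof.
move=> cxs; rewrite -(char_exponent_pullback c xs j).
have kge0 m : 0 <= k m by rewrite ltW.
have [B HB] := pullback_bounded c j cT cxs.
exact: (cintegral_expi
  (h := to_functional (pullback_linear T c xs j)) hmu
  (continuous_pullback cT cxs) (char_term_summable kge0 alpha0 ksum HB)).
Qed.

(** The product of two waves is the wave of the sum [h] of their functionals, so
    the covariance is the codifference of these functionals. *)
Lemma covariance_phase_wave_le c d (xs ys : {linear E -> R[i]^o}) i j n (D : R) :
  continuous xs -> continuous ys ->
  (\esum_(m in [set: int]) (k m `^ alpha * (normc (pullback T c xs i (e m)) *
     normc (pullback T d ys (j + n) (e m))) `^ (alpha / 2))%:E <= D%:E)%E ->
  normc (covariance_at mu T n (phase_wave T c xs i) (phase_wave T d ys j)) <=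
  2 * D.
Proof.
move=> cxs cys HD.
have kge0 m : 0 <= k m by rewrite ltW.
pose h : E -> R[i]^o := fun z => pullback T c xs i z + pullback T d ys (j + n) z.
have lh : linear h.
  by move=> s x y; rewrite /h !pullback_linear scalerDr addrACA.
have ch : continuous h.
  move=> z; have hx := @continuous_pullback _ _ _ T c xs i cT cxs z.
  have hy := @continuous_pullback _ _ _ T d ys (j + n) cT cys z.
  exact: (cvgD hx hy).
have fin (u : E -> R[i]) : (exists B, forall m, normc (u (e m)) <= B) ->
    (\esum_(m in [set: int]) (char_term k alpha u m)%:E < +oo)%E.
  by move=> [B HB]; exact: (char_term_summable kge0 alpha0 ksum HB).
have [Bx HBx] := pullback_bounded c i cT cxs.
have [By HBy] := pullback_bounded d (j + n) cT cys.
have hfin : (\esum_(m in [set: int]) (char_term k alpha h m)%:E < +oo)%E.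
  by apply: fin; exists (Bx + By) => m; rewrite (le_trans (le_normcD _ _)) ?lerD.
rewrite /covariance_at.
rewrite (_ : (fun z => _) = fun z => expi (complex.Re (h z))); last first.
  apply/funext => z; rewrite /phase_wave -expiD -raddfD.
  congr (expi (complex.Re (_ + _))).
  by rewrite /pullback iterD.
have -> : cintegral mu (fun z => expi (complex.Re (h z))) =
    (expR (- char_exponent k alpha h))%:C.
  exact: (cintegral_expi (h := to_functional lh) hmu).
rewrite !cintegral_phase_wave// -(char_exponent_pullback c xs i)
  -(char_exponent_pullback d ys (j + n)) -rmorphM -rmorphB normc_real.
by apply: (codifference_le alpha0 alpha2 (fun=> erefl) _ _ hfin HD);
  apply: fin; [exists Bx|exists By].
Qed.

End weighted_shift.

(** * The rate of decay *)

Lemma le_of_ereal_sup_eq (R : realType) (I : Type) (A : set I) (v : I -> R)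
    (m : R) :
  m%:E = ereal_sup [set (v l)%:E | l in A] -> forall l, A l -> v l <= m.
Proof.
by move=> mE l Al; rewrite -lee_fin mE; apply: ereal_sup_ubound; exists l.
Qed.

Section shift_rates.
Variables (R : realType) (alpha p : R).
Hypotheses (alpha0 : 0 < alpha) (alphap : alpha < p) (p2alpha : p < 2 * alpha).
Variables (etam etap : R).
Hypotheses (m0 : 0 < etam) (m1 : etam < 1) (e0 : 0 < etap) (e1 : etap < 1).

Let p0 : 0 < p := lt_trans alpha0 alphap.

(** The bound of the theorem is the [n]-th power of this number; compare
    [rateX]. *)
Definition rate := Num.max (etam `^ (2 * alpha / p - 1)) etap `^ (alpha / 2).

Let theta_gt0 : 0 < 2 * alpha / p - 1.
Proof. by rewrite subr_gt0 ltr_pdivlMr// mul1r. Qed.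

Let theta_lt1 : 2 * alpha / p - 1 < 1.
Proof. by rewrite ltrBlDr ltr_pdivrMr// ltr_pM2l. Qed.

Let ltr_powRl (x y : R) : x < y -> etam `^ y < etam `^ x.
Proof.
by move=> xy; rewrite /powR gt_eqF// ltr_expR ltr_nM2r// -ln1 ltr_ln// posrE.
Qed.

Let max_lt1 : Num.max (etam `^ (2 * alpha / p - 1)) etap < 1.
Proof.
by rewrite gt_max e1 andbT -[ltRHS](powRr0 etam); exact: ltr_powRl.
Qed.

Let max_gt0 : 0 < Num.max (etam `^ (2 * alpha / p - 1)) etap.
Proof. by rewrite lt_max e0 orbT. Qed.

Let a20 : 0 < alpha / 2. Proof. by rewrite divr_gt0. Qed.

Lemma rate_gt0 : 0 < rate.
Proof. exact: powR_gt0. Qed.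

Lemma rate_lt1 : rate < 1.
Proof.
have -> : 1 = 1 `^ (alpha / 2) :> R by rewrite powR1.
by apply: gt0_ltr_powR; rewrite ?nnegrE ?(ltW max_gt0).
Qed.

(** Strict because the exponent [2 * alpha / p - 1] is less than 1. *)
Lemma rate_gt_etam : etam `^ (alpha / 2) < rate.
Proof.
apply: gt0_ltr_powR; rewrite ?nnegrE ?(ltW m0) ?(ltW max_gt0)//.
by rewrite lt_max -[X in X < _]powRr1 ?(ltW m0)// ltr_powRl.
Qed.

Lemma rate_ge_etap : etap `^ (alpha / 2) <= rate.
Proof.
apply: ge0_ler_powR; rewrite ?nnegrE ?(ltW e0) ?(ltW max_gt0) ?(ltW a20)//.
by rewrite le_max lexx orbT.
Qed.

(** With [theta := 2 * alpha / p - 1], the claim reduces to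
    [theta * alpha <= p], that is to [(alpha - p) * (2 * alpha + p) <= 0]. *)
Lemma rate_inv_le (N : R) : etam^-1 <= N -> rate^-1 <= N `^ (p / 2).
Proof.
move=> mN.
have N0 : 0 <= N by apply: le_trans mN; rewrite invr_ge0 ltW.
apply: (@le_trans _ _ (etam^-1 `^ (p / 2))); last first.
  by apply: ge0_ler_powR; rewrite ?nnegrE ?invr_ge0 ?divr_ge0 ?(ltW p0) ?(ltW m0).
rewrite powRV ?(ltW m0)// lef_pV2 ?posrE ?powR_gt0// ?rate_gt0//.
apply: (@le_trans _ _ ((etam `^ (2 * alpha / p - 1)) `^ (alpha / 2))).
  rewrite -powRrM; apply: ger_powR; first by rewrite m0 ltW.
  rewrite mulrA ler_pM2r// mulrBl mul1r lerBlDr mulrAC ler_pdivrMr//.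
  have : 0 <= (p - alpha) * (2 * alpha + p).
    by rewrite mulr_ge0 ?subr_ge0 ?addr_ge0 ?mulr_ge0 ?ltW.
  lra.
apply: ge0_ler_powR; rewrite ?nnegrE ?powR_ge0 ?(ltW max_gt0) ?(ltW a20)//.
by rewrite le_max lexx.
Qed.

Lemma rateX n :
  Num.max (etam `^ (2 * alpha / p - 1)) etap `^ (alpha * n%:R / 2) = rate ^+ n.
Proof.
by rewrite -powR_mulrn ?(ltW rate_gt0)// /rate -powRrM (mulrAC alpha).
Qed.

End shift_rates.

(** * Decay of correlations *)

Theorem corollary5p3 (R : realType) (alpha p : R)
  (halpha : 1 / 2 < alpha < 2) (halpha1 : alpha != 1)
  (hp : alpha < p < 2 * alpha) (p1 : 1 <= p) (p2 : p <= 2)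
  (k0 : R) (hk0 : 0 < k0) (w : int -> R) (hw : forall n, 0 < w n)
  (hk : (lsum alpha (kseq k0 w) < +oo)%E)
  (qm qp : nat) (hqp : (1 <= qp)%N) (etam etap : R)
  (hetam : etam%:E =
     ereal_sup [set ((w l)^-1)%:E | l in [set l : int | l <= - qm%:Z]])
  (hetam1 : etam < 1)
  (hetap : etap%:E = ereal_sup [set (w l)%:E | l in [set l : int | qp%:Z <= l]])
  (hetap1 : etap < 1)
  (hetaneq : etap `^ (p / 2) != etam `^ (alpha - p / 2))
  (mu : probability (borel (ellp p1)) R)
  (hmu : has_char_functional mu (xi p1 (kseq k0 w) alpha) alpha)
  (T : {linear ellp p1 -> ellp p1}) (hTb : bounded_operator T)
  (hT : forall n : int, T (ebasis p1 n) = (w (n + 1))%:C *: ebasis p1 (n + 1))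
  (phi psi : R[i] -> R) (hphi : phases phi) (hpsi : phases psi)
  (hneq : phi <> psi)
  (a b : nat -> R[i])
  (ha : (\sum_(0 <= j <oo) (normc (a j))%:E < +oo)%E)
  (hb : (\sum_(0 <= l <oo) (normc (b l))%:E < +oo)%E)
  (haT : (\sum_(0 <= j <oo)
            (normc (a j) * opnorm T `^ (j%:R * p / 2))%:E < +oo)%E)
  (hbT : (\sum_(0 <= l <oo)
            (normc (b l) * opnorm T `^ (l%:R * p / 2))%:E < +oo)%E)
  (xs ys : {linear ellp p1 -> R[i]^o})
  (hxs : continuous xs) (hys : continuous ys) :
  let f := exp_series a phi T xs in
  let g := exp_series b psi T ys in
  [/\ exp_series_in_L2 mu a phi T xs,
      exp_series_in_L2 mu b psi T ys &
      exists C : R, 0 < C /\ forall n : nat,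
        normc (covariance_at mu T n f g) <=
        C * `|Num.max (etam `^ (2 * alpha / p - 1)) etap
                `^ (alpha * n%:R / 2)| ].
Proof.
move=> f g.
have [/andP[alpha_gt alpha2] /andP[alphap p2alpha]] := (halpha, hp).
have alpha0 : 0 < alpha by apply: lt_trans alpha_gt; rewrite divr_gt0.
have wm := le_of_ereal_sup_eq hetam; have wp := le_of_ereal_sup_eq hetap.
have em0 : 0 < etam.
  by apply: lt_le_trans (wm (- qm%:Z) (lexx _)); rewrite invr_gt0.
have ep0 : 0 < etap by apply: lt_le_trans (wp qp%:Z (lexx _)).
have cT := bounded_operator_continuous hTb.
have [c c1 phiE] := phasesP hphi; have [d d1 psiE] := phasesP hpsi.
have aA := nnseries_is_cvg (fun j => normc_ge0 (a j)) ha.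
have bB := nnseries_is_cvg (fun j => normc_ge0 (b j)) hb.
have aT0 j := mulr_ge0 (normc_ge0 (a j)) (powR_ge0 (opnorm T) (j%:R * p / 2)).
have leAT J := series_le_lim J aT0 (nnseries_is_cvg aT0 haT).
set B := limn (series (fun j => normc (b j))) in bB.
set AT := limn (series _) in leAT.
have B0 : 0 <= B.
  by have := series_le_lim 0 (fun j => normc_ge0 (b j)) bB; rewrite big_geq.
have AT0 : 0 <= AT by have := leAT 0%N; rewrite big_geq.
have [fL2 fb fz] := exp_series_bmfun mu cT aA hxs phiE.
have [gL2 gb gz] := exp_series_bmfun mu cT bB hys psiE.
split=> //.
set r := rate alpha p etam etap.
have r0 : 0 < r by exact: rate_gt0.
have r1 : r < 1 by exact: rate_lt1.
have a20 : 0 < alpha / 2 by rewrite divr_gt0.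
have kge0 m : 0 <= kseq k0 w m by rewrite ltW// kseq_gt0.
have kapP (n : nat) : (qp <= n)%N ->
    kseq k0 w n.+1%:Z `^ (alpha / 2) <=
    etap `^ (alpha / 2) * kseq k0 w n%:Z `^ (alpha / 2).
  move=> qn; rewrite -powRM ?(ltW ep0)// -addn1 PoszD kseqS//.
  apply: ge0_ler_powR; rewrite ?nnegrE ?(ltW a20)//.
  - exact: mulr_ge0 (ltW (hw _)) (kge0 _).
  - exact: mulr_ge0 (ltW ep0) (kge0 _).
  - apply: ler_wpM2r (kge0 _) _ _ _; apply: wp.
    by rewrite /= -PoszD lez_nat addn1 leqW.
have kapN (n : nat) : (qm <= n)%N ->
    kseq k0 w (- n.+1%:Z) `^ (alpha / 2) <=
    etam `^ (alpha / 2) * kseq k0 w (- n%:Z) `^ (alpha / 2).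
  move=> qn; rewrite -powRM ?(ltW em0)//.
  have -> : kseq k0 w (- n%:Z) = w (- n%:Z) * kseq k0 w (- n.+1%:Z).
    rewrite -[n.+1]addn1 PoszD opprD -[in LHS](subrK 1 (- n%:Z)).
    by rewrite kseqS// subrK.
  apply: ge0_ler_powR; rewrite ?nnegrE ?(ltW a20)//.
    exact: mulr_ge0 (ltW em0) (mulr_ge0 (ltW (hw _)) (kge0 _)).
  rewrite mulrA ler_peMl// -ler_pdivrMr// mul1r.
  by apply: wm => /=; rewrite lerN2 lez_nat.
have [S S0 HS] := weight_correlation_le (powR_gt0 _ em0) (powR_gt0 _ ep0)
  (rate_gt_etam alpha0 alphap em0 hetam1 ep0)
  (rate_ge_etap p alpha0 etam ep0) r1 kapP kapN.
have [Bx Bx0 xB] := functional_bounded hxs.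
have [By By0 yB] := functional_bounded hys.
pose D := (Bx * By) `^ (alpha / 2) * S.
have D0 : 0 <= D by rewrite mulr_ge0 ?powR_ge0.
have cov i j n : normc (covariance_at mu T n
    (phase_wave T c xs i) (phase_wave T d ys j)) <= 2 * (D * r ^+ n / r ^+ i).
  apply: (covariance_phase_wave_le hk0 hw hT alpha0 (ltW alpha2) hk cT hmu
    hxs hys).
  set P := (Bx * By) `^ (alpha / 2).
  have P0 : 0 <= P by exact: powR_ge0.
  apply: (@le_trans _ _ (\esum_(m in [set: int]) (P *
      (kseq k0 w (m + i%:Z) `^ (alpha / 2) *
       kseq k0 w (m + (j + n)%:Z) `^ (alpha / 2)))%:E)%E).
    apply: le_esum => m _; rewrite lee_fin.
    exact: (cross_term_pullback_le hk0 hw hT alpha0 i (j + n) m c1 d1).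
  apply: (le_trans (esum_scale_le P0 _)).
    by move=> m; rewrite mulr_ge0 ?powR_ge0.
  apply: (le_trans (lee_wpmul2l _ (HS i (j + n)%N))); first by rewrite lee_fin.
  (* the correlation decays in j + n, and the factor r ^+ j is at most 1 *)
  rewrite -EFinM lee_fin /D -/P !mulrA ler_wpM2r ?invr_ge0 ?exprn_ge0 ?(ltW r0)//.
  rewrite ler_wpM2l ?mulr_ge0// exprD ler_piMl ?exprn_ge0 ?(ltW r0)//.
  by rewrite exprn_ile1 ?ltW.
clearbody D.
have w1 : etam^-1 <= opnorm T.
  apply: (@le_trans _ _ (w (- qm%:Z))).
    by rewrite invf_ple ?posrE// wm/=.
  have := @le_opnorm _ _ p1 T (ebasis p1 (- qm%:Z - 1)) hTb.
  rewrite ellp_norm_ebasis hT subrK ellp_normZ ellp_norm_ebasis mulr1.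
  by rewrite normc_real gtr0_norm// => /(_ (lexx _)).
have rinv j : (r ^+ j)^-1 <= opnorm T `^ (j%:R * p / 2).
  have -> : opnorm T `^ (j%:R * p / 2) = (opnorm T `^ (p / 2)) ^+ j.
    by rewrite -powR_mulrn ?powR_ge0// -powRrM (mulrC (p / 2)) mulrA.
  rewrite -exprVn lerXn2r ?nnegrE ?powR_ge0 ?invr_ge0 ?(ltW r0)//.
  exact: (rate_inv_le alpha0 alphap em0 hetam1 ep0 w1).
have miter n :
    measurable_fun setT (iter n T : borel (ellp p1) -> borel (ellp p1)).
  by apply: continuous_borel_measurable_self; exact: continuous_iter.
have ub := bmfun_phase_wave cT c hxs; have vb := bmfun_phase_wave cT d hys.
(* the summand 1 only makes the constant positive *)
exists (2 * D * B * AT + 1); split.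
  by rewrite ltr_wpDl ?mulr_ge0.
move=> n; rewrite (rateX alpha p etam ep0) -/r ger0_norm ?exprn_ge0 ?(ltW r0)//.
rewrite mulrDl mul1r ler_wpDr ?exprn_ge0 ?(ltW r0)//.
have -> : 2 * D * B * AT * r ^+ n = 2 * D * r ^+ n * B * AT by ring.
apply: (covariance_at_series_le (miter n) (q := fun i => (r ^+ i)^-1)
  aA bB ub vb gb fz gz) => //.
- by rewrite !mulr_ge0// exprn_ge0// ltW.
- by move=> i; rewrite invr_ge0 exprn_ge0// ltW.
- by move=> i j; rewrite (le_trans (cov i j n))// !mulrA.
- move=> J; apply: le_trans (leAT J); apply: ler_sum => i _.
  by rewrite ler_wpM2l ?normc_ge0.
Qed.
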